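(* Let $A=\alpha\,d\varphi$ with $\alpha\in\mathbb R$. Write $\alpha=n+\gamma$, where $n\in\mathbb Z$ and $\gamma=\pm d(\alpha,\mathbb Z)$. Then, for any $u\in C_c^\infty(\mathbb H^1\setminus\mathcal Z)$, the following hold: (i) If $\gamma\langle-i\Phi u,ur^{-1}\rangle\ge-\gamma n\int_{\mathbb H^1}\frac{|u|^2}{r^2}\,dq$, then $$Q_\alpha(u)-\int_{\mathbb H^1}\frac{r^2}{\rho^4}|u|^2\,dq\ \ge\ d(\alpha,\mathbb Z)^2\int_{\mathbb H^1}\frac{|u|^2}{r^2}\,dq.$$ In particular, for real-valued $u$ this always holds if $\gamma n\ge0$ (e.g., if $|\alpha|\le1/2$). (ii) If $-i\partial_\varphi u=nu$, or if $u(x,y,z)=u(x,y,-z)$, then $$Q_\alpha(u)-\int_{\mathbb H^1}\frac{r^2}{\rho^4}|u|^2\,dq\ \ge\ d(\alpha,\mathbb Z)^2\int_{\mathbb H^1}\frac{|u|^2}{r^2}\left(1-|\nabla\rho|^4\right)dq.$$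
   Context: The Heisenberg group $\mathbb H^1$ is $\mathbb R^3$ with coordinates $(x,y,z)$ and left-invariant vector fields $X=\partial_x-\frac y2\partial_z$, $Y=\partial_y+\frac x2\partial_z$. Set $\mathcal Z=\{(0,0,z):z\in\mathbb R\}$, $r=\sqrt{x^2+y^2}$, $\rho=\left((x^2+y^2)^2+16z^2\right)^{1/4}$. In cylindrical coordinates $(x,y)=(r\cos\varphi,r\sin\varphi)$ on $\mathbb H^1\setminus\mathcal Z$, let $R=\partial_r$ and $\Phi=\frac1r\partial_\varphi+\frac r2\partial_z$. $dq=dx\,dy\,dz=r\,dr\,d\varphi\,dz$, and $\langle\cdot,\cdot\rangle$ is the inner product of $L^2(\mathbb H^1)$, linear in the first argument. $\nabla\rho=(X\rho)X+(Y\rho)Y$ is the horizontal gradient, with $|\nabla\rho|^2=(X\rho)^2+(Y\rho)^2=r^2/\rho^2$. $d(\alpha,\mathbb Z)$ is the distance from $\alpha$ to the integers. The magnetic form of the potential $\alpha\,d\varphi$ is $$Q_\alpha(u)=\int_{\mathbb H^1}\left(|Ru|^2+\left|\Phi u+\frac{i\alpha}{r}u\right|^2\right)dq.$$ *)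

(* Defs.v *)
From HB Require Import structures.
From mathcomp Require Import all_boot all_order all_algebra.
From mathcomp Require Import all_classical all_reals all_analysis.
From mathcomp Require Import complex.

Set Implicit Arguments.
Unset Strict Implicit.
Unset Printing Implicit Defensive.

Import Order.TTheory GRing.Theory Num.Theory.
Import numFieldNormedType.Exports.

Local Open Scope classical_set_scope.
Local Open Scope ring_scope.
Local Open Scope complex_scope.

Notation heis R := (R * R * R)%type.

Section Heisenberg.
Context {R : realType}.
Implicit Types (f g : heis R -> R) (u v : heis R -> R[i]) (q : heis R).

Definition cx q : R := q.1.1.
Definition cy q : R := q.1.2.
Definition cz q : R := q.2.

Definition e_x : heis R := (1, 0, 0).
Definition e_y : heis R := (0, 1, 0).
Definition e_z : heis R := (0, 0, 1).

Definition zaxis : set (heis R) := [set q | cx q = 0 /\ cy q = 0].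

Definition rr q : R := Num.sqrt (cx q ^+ 2 + cy q ^+ 2).

Definition rho q : R :=
  ((cx q ^+ 2 + cy q ^+ 2) ^+ 2 + 16 * cz q ^+ 2) `^ (1 / 4).

Definition Xf f q : R := 'D_e_x f q - cy q / 2 * 'D_e_z f q.
Definition Yf f q : R := 'D_e_y f q + cx q / 2 * 'D_e_z f q.

Definition hgrad_norm f q : R := Num.sqrt (Xf f q ^+ 2 + Yf f q ^+ 2).

(* Complex-valued functions are differentiated through their real and
   imaginary parts, since R[i] carries no normedModType R structure. *)
Definition cderive1 (h : R -> R[i]) (t : R) : R[i] :=
  derive1 (fun s => complex.Re (h s)) t +i* derive1 (fun s => complex.Im (h s)) t.

Definition cyl (s t z : R) : heis R := (s * cos t, s * sin t, z).

Definition rot (t : R) q : heis R :=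
  (cx q * cos t - cy q * sin t, cx q * sin t + cy q * cos t, cz q).

(* The coordinate derivatives along the curves s |-> cyl s phi z and
   t |-> cyl r t z through q, written without choosing an angle phi of q:
   (cos phi, sin phi) = (x / r, y / r), and shifting phi by t is rot t.
   See partial_r_cyl and partial_phi_cyl. *)
Definition partial_r u q : R[i] :=
  cderive1 (fun s => u (s * (cx q / rr q), s * (cy q / rr q), cz q)) (rr q).

Definition partial_phi u q : R[i] := cderive1 (fun t => u (rot t q)) 0.

Definition partial_z u q : R[i] := cderive1 (fun s => u (cx q, cy q, s)) (cz q).

Definition Phi u q : R[i] :=
  (rr q)^-1%:C * partial_phi u q + (rr q / 2)%:C * partial_z u q.

Fixpoint Ck (k : nat) f : Prop :=
  continuous f /\
  if k is k'.+1 then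
    forall e, e \in [:: e_x; e_y; e_z] ->
      (forall q, derivable f q e) /\ Ck k' (fun q => 'D_e f q)
  else True.

Definition smooth f := forall k, Ck k f.

Definition csupport u : set (heis R) := closure [set q | u q != 0].

(* An element of C_c^oo of the complement of the z-axis is represented by its
   extension by zero to the whole space; it vanishes near the axis, so the
   convention x / 0 = 0 in the quotients by rr q below is immaterial. *)
Definition test_function u :=
  [/\ smooth (fun q => complex.Re (u q)), smooth (fun q => complex.Im (u q)),
      compact (csupport u) & csupport u `<=` ~` zaxis].

Definition dq : {measure set (heis (measurableTypeR R)) -> \bar R} :=
  ((@lebesgue_measure R \x @lebesgue_measure R) \x @lebesgue_measure R)%E.

Definition hintegral f : R := (\int[dq]_q f q)%R.

Definition sqn (w : R[i]) : R := Normc.normc w ^+ 2.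

Definition inner u v : R[i] :=
  hintegral (fun q => complex.Re (u q * ((v q)^*)%C)) +i*
  hintegral (fun q => complex.Im (u q * ((v q)^*)%C)).

Definition Qform (alpha : R) u : R :=
  hintegral (fun q =>
    sqn (partial_r u q) + sqn (Phi u q + 'i%C * (alpha / rr q)%:C * u q)).

Definition distZ (alpha : R) : R :=
  inf [set `|alpha - m%:~R| | m in [set: int]].

Definition splits (alpha : R) (n : int) (gamma : R) : Prop :=
  alpha = n%:~R + gamma /\ (gamma = distZ alpha \/ gamma = - distZ alpha).

Definition hardy_weighted u : R :=
  hintegral (fun q => rr q ^+ 2 / rho q ^+ 4 * sqn (u q)).

Definition inv_square_weighted u : R :=
  hintegral (fun q => sqn (u q) / rr q ^+ 2).

Definition inv_square_weighted_grad u : R :=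
  hintegral (fun q => sqn (u q) / rr q ^+ 2 * (1 - hgrad_norm rho q ^+ 4)).

(* The order is that of R[i], in which x <= y forces Im x = Im y; here the
   inner product is real because Phi is skew-symmetric. *)
Definition angular_condition (n : int) (gamma : R) u : Prop :=
  gamma%:C * inner (fun q => - 'i%C * Phi u q) (fun q => u q * (rr q)^-1%:C)
  >= (- gamma * n%:~R * inv_square_weighted u)%:C.

Lemma rr_cyl (s t z : R) : 0 <= s -> rr (cyl s t z) = s.
Proof.
move=> s0; rewrite /rr /cx /cy /= !exprMn -mulrDr cos2Dsin2 mulr1.
by rewrite sqrtr_sqr ger0_norm.
Qed.

Lemma rot_cyl (s t t' z : R) : rot t' (cyl s t z) = cyl s (t + t') z.
Proof.
rewrite /rot /cyl /cx /cy /cz /= cosD sinD !mulrBr !mulrDr !mulrA.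
by congr (_, _, _); rewrite addrC.
Qed.

Lemma partial_r_cyl u (s t z : R) : 0 < s ->
  partial_r u (cyl s t z) = cderive1 (fun s' => u (cyl s' t z)) s.
Proof.
move=> s0; rewrite /partial_r rr_cyl ?ltW// /cyl /cx /cy /cz /=.
by rewrite ![s * _ / s]mulrAC divff ?gt_eqF// !mul1r.
Qed.

Lemma partial_phi_cyl u (s t z : R) :
  partial_phi u (cyl s t z) = cderive1 (fun t' => u (cyl s t' z)) t.
Proof.
have shift0 (f : R -> R) : derive1 (fun t' => f (t + t')) 0 = derive1 f t.
  rewrite /derive1 addr0.
  suff -> : (fun h => h^-1 *: (f (t + (h + 0)) - f t)) =
            (fun h => h^-1 *: (f (h + t) - f t)) by [].
  by apply/funext => h; rewrite addr0 (addrC t).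
rewrite /partial_phi /cderive1; congr (_ +i* _).
- rewrite -(shift0 (fun t' => complex.Re (u (cyl s t' z)))).
  by congr (derive1 _ 0); apply/funext => t'; rewrite rot_cyl.
- rewrite -(shift0 (fun t' => complex.Im (u (cyl s t' z)))).
  by congr (derive1 _ 0); apply/funext => t'; rewrite rot_cyl.
Qed.

End Heisenberg.

(* Main.v *)
(* Off the axis, expanding a perfect square built from r R u, t (r Phi u + i n u) and u, with
   t = 4 z / r^2, shows that Q_alpha(u) minus the Hardy term is a nonnegative integral up to
   integrals that vanish by integration by parts along the dilation and rotation fields; the terms
   in gamma are those of the hypothesis of (i), which gives (i).
   For u even in z the cross term between d_phi u + i alpha u and d_z u is odd, so it vanishes, and
   the angular term is bounded below by the Wirtinger inequality on circles, averaged over q by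
   means of the rotation invariance of dq.
   For an eigenfunction of d_phi one completes squares with an extra multiple k of the dilation
   derivative E u = (x d_x + y d_y + 2 z d_z + 1) u; the additional term is the integral of a
   Jacobian determinant, hence zero, and for k = - beta / (1 + beta^2 - gamma^2), beta = alpha + n,
   the remaining quadratic form in (E u, t u) is nonnegative. *)

Require Import Defs.
From HB Require Import structures.
From mathcomp Require Import all_boot all_order all_algebra.
From mathcomp Require Import all_classical all_reals all_analysis.
From mathcomp Require Import complex.
From mathcomp Require Import measurable_realfun ring lra.

Import Order.TTheory GRing.Theory Num.Theory.
Import numFieldNormedType.Exports.

Set Implicit Arguments.
Unset Strict Implicit.
Unset Printing Implicit Defensive.

Local Open Scope classical_set_scope.
Local Open Scope ring_scope.

(** The ratio [t = 4 z / r^2] is [Phi rho / R rho]. With [b] for the angular component,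
    [r R u + t b] and [b - t r R u] are, up to a common factor, the components of the gradient along
    and across that of [rho]. As [rho^4 = r^4 (1 + t^2)], the weight [r^2 / rho^4] restores
    [|R u|^2 + |Phi u|^2] from them, and adding [u] to the first completes the Hardy square. The
    gain in (ii) has the same scale: [(1 - |grad rho|^4) / r^2 = t^2 r^2 / rho^4]. For
    eigenfunctions this alone falls short: at [k = 0] the form in [(E u, t u)] has determinant
    [(beta^2 - gamma^2) - beta^2 = - gamma^2]. The multiple [k] of the Jacobian is there to repair
    the sign. Two features of the setting shape the rest. Smoothness is given by iterated
    directional derivatives along the axes only, so the chain rule and the symmetry of second
    derivatives have to be derived. The weights are singular on the axis, but everything integrated
    vanishes near it. *)

Section continuous_at_ops.
Context (T : topologicalType) (R : realType).
Implicit Types (f g : T -> R) (x : T).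

Lemma continuous_atD f g x : continuous_at x f -> continuous_at x g ->
  continuous_at x (fun y => f y + g y).
Proof. by move=> cf cg; apply: cvgD. Qed.

Lemma continuous_atM f g x : continuous_at x f -> continuous_at x g ->
  continuous_at x (fun y => f y * g y).
Proof. by move=> cf cg; apply: cvgM. Qed.

Lemma continuous_atN f x : continuous_at x f -> continuous_at x (fun y => - f y).
Proof. by move=> cf; apply: cvgN. Qed.

Lemma continuous_atX f n x : continuous_at x f -> continuous_at x (fun y => f y ^+ n).
Proof.
move=> cf; apply: (@continuous_comp _ _ _ f (fun y => y ^+ n)) => //.
exact: exprn_continuous.
Qed.

Lemma continuous_atV f x : f x != 0 -> continuous_at x f ->
  continuous_at x (fun y => (f y)^-1).
Proof. by move=> f0 cf; apply: cvgV. Qed.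

Lemma continuous_at_cst (k : R) x : continuous_at x (fun _ : T => k).
Proof. exact: cvg_cst. Qed.

End continuous_at_ops.

(** Each inverse leaves its goal [f x != 0] to the caller; atoms are closed by [continuous_at]
    hypotheses of the context, possibly guarded by a side condition. *)
Ltac continuity := lazymatch goal with
  | |- continuous_at _ (fun _ => ?k) => exact: continuous_at_cst
  | |- continuous_at _ (fun y => @?f y + @?g y) =>
      apply: (@continuous_atD _ _ f g); continuity
  | |- continuous_at _ (fun y => - @?f y) => apply: (@continuous_atN _ _ f); continuity
  | |- continuous_at _ (fun y => @?f y * @?g y) =>
      apply: (@continuous_atM _ _ f g); continuity
  | |- continuous_at _ (fun y => @?f y ^+ ?n) => apply: (@continuous_atX _ _ f n); continuity
  | |- continuous_at _ (fun y => (@?f y)^-1) => apply: (@continuous_atV _ _ f); [|continuity]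
  | |- continuous_at ?x (fun y => ?g y) => change (continuous_at x g); continuity
  | |- continuous_at ?x ?g => match goal with
    | H : continuous_at x g |- _ => exact H
    | H : forall t, continuous_at t g |- _ => exact (H x)
    | H : forall t, _ -> continuous_at t g |- _ => apply: H; assumption
    end
  end.

(** * Borel sets, sigma-finiteness and Fubini for the volume *)

Lemma bigcup_rat_measurable d (T : measurableType d) (I : countType) (F : I -> set T) :
  (forall i, measurable (F i)) -> measurable (\bigcup_i F i).
Proof.
move=> mF; have -> : \bigcup_i F i = \bigcup_n (if unpickle n is Some i then F i else set0).
  apply/seteqP; split=> [x [i _ Fx]|x [n _]].
    by exists (pickle i) => //; rewrite pickleK.
  by case: unpickle => // i Fx; exists i.
by apply: bigcupT_measurable => n; case: unpickle.
Qed.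

(** The product sigma-algebra is not defined from the topology; second countability links them: an
    open set is the union of the rational cubes that it contains. *)
Lemma open_heis_measurable (R : realType) (U : set (heis R)) : open U ->
  measurable (U : set (heis (measurableTypeR R))).
Proof.
move=> oU.
pose B (i : rat * rat * rat * rat) : set (heis R) :=
  (ball (ratr i.1.1.1 : R) (ratr i.2) `*` ball (ratr i.1.1.2 : R) (ratr i.2))
    `*` ball (ratr i.1.2 : R) (ratr i.2).
have mB i : measurable (B i : set (heis (measurableTypeR R))).
  by apply: measurableX; [apply: measurableX|]; (apply: open_measurable; exact: ball_open).
have -> : U = \bigcup_i (if `[< B i `<=` U >] then B i else set0).
  apply/seteqP; split=> [q Uq|q [i _]]; last first.
    by case: asboolP => // BU /BU.
  have /nbhs_ballP[e /= e0 qU] := open_nbhs_nbhs (conj oU Uq).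
  (* With a radius below [e / 2], a cube whose centre is within that radius of [q] contains [q] and
     stays in the [e]-ball. *)
  have e20 : 0 < e / 2 by rewrite divr_gt0.
  have [d] := rat_in_itvoo e20.
  rewrite in_itv/= => /andP[d0 de].
  have app (x : R) : exists a : rat, `|x - ratr a| < ratr d.
    have : x < x + ratr d by rewrite ltrDl.
    move=> /rat_in_itvoo[a]; rewrite in_itv/= => /andP[h1 h2]; exists a.
    by rewrite ltr_norml; apply/andP; split; lra.
  have [a ha] := app q.1.1; have [b hb] := app q.1.2; have [c hc] := app q.2.
  exists (a, b, c, d) => //.
  have sub : B (a, b, c, d) `<=` U.
    move=> p [[/= p1 p2] p3]; apply: qU; rewrite /ball/= /prod_ball/= /prod_ball /=.
    have tri (x a' y : R) : `|x - a'| < ratr d -> `|a' - y| < ratr d -> `|x - y| < e.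
      by rewrite !ltr_norml => /andP[? ?] /andP[? ?]; apply/andP; split; lra.
    by split; [split|]; rewrite -ball_normE /ball_ /=; [apply: (tri _ (ratr a))|
      apply: (tri _ (ratr b))|apply: (tri _ (ratr c))].
  case: asboolP => // _; rewrite /B/=; split; [split|];
    by rewrite /ball/= /ball_/= distrC.
apply: bigcup_rat_measurable => i; case: asboolP => // _; exact: mB.
Qed.

Lemma continuous_heis_measurable (R : realType) (h : heis R -> R) : continuous h ->
  measurable_fun [set: heis (measurableTypeR R)] h.
Proof.
move=> ch; apply: (measurability _ (RGenOpens.measurableE R)).
move=> _ [_ [a [b ->] <-]]; rewrite setTI.
apply: open_heis_measurable; apply: open_comp; last exact: interval_open.
by move=> x _; exact: ch.
Qed.

Lemma product_measure_sigma_finite d1 d2 (T1 : measurableType d1) (T2 : measurableType d2)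
    (R : realType) (m1 : {sigma_finite_measure set T1 -> \bar R})
    (m2 : {sigma_finite_measure set T2 -> \bar R}) :
  sigma_finite setT (m1 \x m2)%E.
Proof.
have /sigma_finiteP[F [TF ndF Foo]] := sigma_finiteT m1.
have /sigma_finiteP[G [TG ndG Goo]] := sigma_finiteT m2.
exists (fun n => F n `*` G n).
  rewrite -setXTT TF TG; apply/seteqP; split=> [[x y] [/= [n _ Fx] [k _ Gy]]|[x y] [n _ []/= ? ?]];
    last by split; exists n.
  exists (maxn n k) => //; split.
    exact: (subsetPset _ _ (ndF _ _ (leq_maxl n k))).
  exact: (subsetPset _ _ (ndG _ _ (leq_maxr n k))).
move=> k; have [mF Fk] := Foo k; have [mG Gk] := Goo k.
by split; [exact: measurableX|rewrite product_measure1E// lte_mul_pinfty// ge0_fin_numE].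
Qed.

(* [dqs] is convertible to [dq]; the two products are named in order to register them as
   sigma-finite, which the iterated Fubini theorems require. *)
Definition leb2 (R : realType) : set (measurableTypeR R * measurableTypeR R)%type -> \bar R :=
  (@lebesgue_measure R \x @lebesgue_measure R)%E.
HB.instance Definition _ (R : realType) := Measure.on (@leb2 R).
HB.instance Definition _ (R : realType) := Measure_isSigmaFinite.Build _ _ _ (@leb2 R)
  (product_measure_sigma_finite lebesgue_measure lebesgue_measure).

Definition dqs (R : realType) : set (heis (measurableTypeR R))%type -> \bar R :=
  (@leb2 R \x @lebesgue_measure R)%E.
HB.instance Definition _ (R : realType) := Measure.on (@dqs R).
HB.instance Definition _ (R : realType) := Measure_isSigmaFinite.Build _ _ _ (@dqs R)
  (product_measure_sigma_finite (@leb2 R) lebesgue_measure).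

(** The norm of the product is the maximum norm, so the support lies in a cube. Stated as a bound,
    this passes directly to slices and to compositions with linear maps. *)
Definition ccont (R : realType) (h : heis R -> R) :=
  continuous h /\ exists M : R, forall q, M < `|q| -> h q = 0.

Lemma bounded_support_integrable d (T : measurableType d) (R : realType)
  (mu : {measure set T -> \bar R}) (h : T -> R) (D : set T) (C : R) :
  measurable D -> (mu D < +oo)%E -> measurable_fun setT h ->
  (forall x, `|h x| <= C) -> (forall x, ~ D x -> h x = 0) ->
  mu.-integrable setT (EFin \o h).
Proof.
move=> mD Dfin mh hC h0.
have -> : EFin \o h = (EFin \o h) \_ D.
  apply/funext => x; rewrite patchE; case: ifPn => //.
  by rewrite notin_setE => /h0 /= ->.
apply/integrable_restrict => //=; rewrite setTI.
apply: measurable_bounded_integrable => //; first exact: measurable_funTS.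
exists C; split; first exact: num_real.
by move=> x Cx y _ /=; exact: le_trans (hC y) (ltW Cx).
Qed.

Lemma norm_heis_le (R : realType) (q : heis R) (M : R) :
  (`|q| <= M) = [&& `|cx q| <= M, `|cy q| <= M & `|cz q| <= M].
Proof. by rewrite /Num.norm/= /cx /cy /cz !ge_max andbA. Qed.

Definition box (R : realType) (M : R) : set (heis R) :=
  (`[- M, M] `*` `[- M, M]) `*` `[- M, M].

Lemma boxE (R : realType) (q : heis R) (M : R) : box M q <-> `|q| <= M.
Proof.
rewrite norm_heis_le /box/= !in_itv/= -!ler_norml /cx /cy /cz.
by split=> [[[-> ->] ->]//|/and3P[-> -> ->]].
Qed.

Lemma compact_box (R : realType) (M : R) : compact (box M).
Proof. by apply: compact_setX; [apply: compact_setX|]; exact: segment_compact. Qed.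

Lemma ccont_bounded (R : realType) (h : heis R -> R) : ccont h ->
  exists C : R, forall q, `|h q| <= C.
Proof.
move=> [ch [M hM]].
have : compact (h @` box M).
  by apply: continuous_compact; [exact: continuous_subspaceT|exact: compact_box].
move=> /compact_bounded [C [_ hC]]; exists (Num.max 0 (C + 1)) => q.
have [/boxE qM|/hM ->] := leP `|q| M; last by rewrite normr0 le_max lexx.
rewrite le_max; apply/orP; right; apply: hC; first by rewrite ltrDl.
by exists q.
Qed.

Lemma measurable_box (R : realType) (M : R) :
  measurable (box M : set (heis (measurableTypeR R))).
Proof. by apply: measurableX; [apply: measurableX|]; exact: measurable_itv. Qed.

Lemma leb2_box (R : realType) (M : R) : (@leb2 R (`[(- M)%R, M] `*` `[(- M)%R, M]) < +oo)%E.
Proof.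
have h := @product_measure1E _ _ _ _ R (@lebesgue_measure R) lebesgue_measure `[- M, M] `[- M, M].
rewrite [X in (X < _)%E]h //.
rewrite /= !lebesgue_measure_itv /=; case: ifP => _; last by rewrite mule0.
by rewrite -!EFinD -!EFinM ltry.
Qed.

Lemma dq_box (R : realType) (M : R) : (@dq R (box M) < +oo)%E.
Proof.
have h := @product_measure1E _ _ _ _ R (@leb2 R) lebesgue_measure (`[- M, M] `*` `[- M, M]) `[- M, M].
rewrite [X in (X < _)%E]h //; last by apply: measurableX.
apply: lte_mul_pinfty => //; last by apply: compact_finite_measure; exact: segment_compact.
by rewrite ge0_fin_numE// leb2_box.
Qed.

Lemma ccont_integrable (R : realType) (h : heis R -> R) : ccont h ->
  (@dq R).-integrable setT (EFin \o h).
Proof.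
move=> hh; have [C hC] := @ccont_bounded R h hh; have [ch [M hM]] := hh.
apply: (@bounded_support_integrable _ (heis (measurableTypeR R)) R (@dq R) h (box M) C) => //.
- exact: measurable_box.
- exact: dq_box.
- exact: continuous_heis_measurable.
- by move=> q bq; apply: hM; rewrite ltNge; apply/negP => /boxE.
Qed.

Lemma ccont_integrable2 (R : realType) (h : heis R -> R) (z : R) : ccont h ->
  (@leb2 R).-integrable setT (fun p => (h (p, z))%:E).
Proof.
move=> hh; have [C hC] := @ccont_bounded R h hh; have [ch [M hM]] := hh.
apply: (@bounded_support_integrable _ (measurableTypeR R * measurableTypeR R)%type R
  (@leb2 R) (fun p => h (p, z)) (`[- M, M] `*` `[- M, M]) C) => //.
- by apply: measurableX.
- exact: leb2_box.
- apply: (measurableT_comp (continuous_heis_measurable ch)).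
  exact: pair2_measurable.
- move=> p bp; apply: hM; rewrite ltNge; apply/negP.
  by move=> /boxE [].
Qed.

(** This and the next two iterations differ in the innermost variable, so that one-variable calculus
    can be applied in any of the three coordinates. *)
Lemma ccont_int_zyx (R : realType) (h : heis R -> R) : ccont h ->
  (\int[@dq R]_q (h q)%:E = \int[lebesgue_measure]_z \int[lebesgue_measure]_y
    \int[lebesgue_measure]_x (h (x, y, z))%:E)%E.
Proof.
move=> hh; have hi := @ccont_integrable R h hh.
rewrite -[LHS](@integral21_prod_meas1 _ _ _ _ _ (@leb2 R) lebesgue_measure) //.
apply: eq_integral => z _; rewrite /fubini_G.
by rewrite -(@integral21_prod_meas1 _ _ _ _ _ lebesgue_measure lebesgue_measure)//;
  exact: ccont_integrable2.
Qed.

Lemma ccont_int_zxy (R : realType) (h : heis R -> R) : ccont h ->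
  (\int[@dq R]_q (h q)%:E = \int[lebesgue_measure]_z \int[lebesgue_measure]_x
    \int[lebesgue_measure]_y (h (x, y, z))%:E)%E.
Proof.
move=> hh; have hi := @ccont_integrable R h hh.
rewrite -[LHS](@integral21_prod_meas1 _ _ _ _ _ (@leb2 R) lebesgue_measure) //.
apply: eq_integral => z _; rewrite /fubini_G.
by rewrite -(@integral12_prod_meas1 _ _ _ _ _ lebesgue_measure lebesgue_measure)//;
  exact: ccont_integrable2.
Qed.

Lemma ccont_int_xyz (R : realType) (h : heis R -> R) : ccont h ->
  (\int[@dq R]_q (h q)%:E = \int[@leb2 R]_p \int[lebesgue_measure]_z (h (p, z))%:E)%E.
Proof.
move=> hh; have hi := @ccont_integrable R h hh.
by rewrite -[LHS](@integral12_prod_meas1 _ _ _ _ _ (@leb2 R) lebesgue_measure).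
Qed.

(** * Integrals over the line: derivatives, reflection, translation *)

Section line.
Variable R : realType.
Let mu := @lebesgue_measure R.

Lemma integral_line_itv (g : R -> R) (N : R) : (forall x, N < `|x| -> g x = 0) ->
  (\int[mu]_x (g x)%:E = \int[mu]_(x in `[(- N)%R, N]) (g x)%:E)%E.
Proof.
move=> g0; rewrite [RHS]integral_mkcond; apply: eq_integral => x _.
rewrite patchE; case: ifPn => //; rewrite notin_setE/= in_itv/= -ler_norml => /negP.
by rewrite -ltNge => /g0 ->.
Qed.

Lemma integral_derivative_line (F f : R -> R) (M : R) :
  continuous f -> (forall x : R, is_derive x 1 F (f x)) ->
  (forall x, M < `|x| -> F x = 0) -> (\int[mu]_x (f x)%:E = 0)%E.
Proof.
move=> cf dF F0.
have f0 x : M < `|x| -> f x = 0.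
  move=> Mx; rewrite -(@derive_val _ _ _ _ _ _ _ (dF x)).
  have -> : 'D_1 F x = 'D_1 (cst 0) x; last by rewrite derive_cst.
  apply: near_eq_derive.
  have : \forall y \near x, M < `|y|.
    exact: (@cvgr_gt _ _ _ _ _ `|x| (@norm_continuous _ _ x)).
  by apply: filterS => y My; rewrite F0.
(* [F] vanishes only where [M < |x|] strictly, and [M] may be negative; this [N] is positive and
   both ends of [[- N, N]] are zeros of [F]. *)
pose N : R := `|M| + 1.
have N0 : 0 < N by rewrite ltr_pwDr.
have MN x : N <= x -> M < `|x|.
  by move=> Nx; rewrite (le_lt_trans (ler_norm M))// (lt_le_trans _ (le_trans Nx (ler_norm _)))// ltrDl.
rewrite (@integral_line_itv _ N); last first.
  by move=> x Nx; apply: f0; rewrite (le_lt_trans (ler_norm M))// (lt_trans _ Nx)// ltrDl.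
have cF : continuous F.
  by move=> x; apply: differentiable_continuous; apply/derivable1_diffP; apply: ex_derive.
rewrite (@continuous_FTC2 R f F).
- rewrite F0; last exact: MN.
  by rewrite F0 ?subee//; rewrite normrN; exact: MN.
- by rewrite gtrN.
- exact: continuous_subspaceT.
- split.
  + by move=> x _; apply: ex_derive.
  + exact/cvg_at_right_filter/cF.
  + exact/cvg_at_left_filter/cF.
- by move=> x _; rewrite derive1E derive_val.
Qed.

Lemma integral_reflection_line (g : R -> R) (M : R) : continuous g ->
  (forall x, M < `|x| -> g x = 0) ->
  (\int[mu]_x (g (- x)%R)%:E = \int[mu]_x (g x)%:E)%E.
Proof.
move=> cg g0; rewrite (@integral_line_itv g M)//.
rewrite (@integral_line_itv (fun x => g (- x)) M); last first.
  by move=> x Mx; apply: g0; rewrite normrN.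
have [M0|M0] := leP (- M) M; last first.
  by rewrite set_itv_ge ?bnd_simp -?ltNge// !integral_set0.
have := @integration_by_substitution_oppr R g (- M) M M0.
rewrite opprK => -> //; exact: continuous_subspaceT.
Qed.

Lemma integral_translation_line (g : R -> R) (M c : R) : continuous g ->
  (forall x, M < `|x| -> g x = 0) ->
  (\int[mu]_x (g (x + c)%R)%:E = \int[mu]_x (g x)%:E)%E.
Proof.
move=> cg g0; pose N : R := `|M| + `|c| + 1.
have dF x : is_derive x (1 : R) (fun y : R => y + c) 1.
  by apply: is_derive_eq; rewrite addr0.
have F' : derive1 (fun y : R => y + c) = cst 1.
  by apply/funext => x; rewrite derive1E derive_val.
have NN : - N <= N by rewrite /N; have := normr_ge0 M; have := normr_ge0 c; lra.
have -> : (\int[mu]_x (g x)%:E = \int[mu]_(x in `[(- N + c)%R, (N + c)%R]) (g x)%:E)%E.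
  rewrite [RHS]integral_mkcond; apply: eq_integral => x _.
  rewrite patchE; case: ifPn => //; rewrite notin_setE/= in_itv/= => h.
  rewrite g0// ltNge; apply/negP => xM; apply: h; move: xM; rewrite /N.
  have := ler_norm M; have := ler_norm c; have := ler_norm (- c); rewrite normrN.
  by rewrite ler_norml => ? ? ? /andP[? ?]; apply/andP; split; lra.
rewrite (@integral_line_itv (fun x => g (x + c)) N); last first.
  move=> x Nx; apply: g0; have := ler_norm M; move: Nx; rewrite /N.
  have := ler_normB (x + c) c; rewrite addrK.
  by move=> ? ? ?; lra.
rewrite (@integration_by_substitution_increasing R (fun y => y + c) g (- N) N) //.
- by apply: eq_integral => x _; rewrite F' /= mulr1.
- by move=> x y _ _; rewrite ltrD2r.
- by rewrite F' => x _; exact: cvg_cst.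
- by rewrite F'; exact: is_cvg_cst.
- by rewrite F'; exact: is_cvg_cst.
- split.
  + by move=> x _; apply: ex_derive.
  + by apply: cvg_at_right_filter; apply: cvgD => //; exact: cvg_cst.
  + by apply: cvg_at_left_filter; apply: cvgD => //; exact: cvg_cst.
- exact: continuous_subspaceT.
Qed.

End line.

(** Along an affine curve of velocity [v] the two difference quotients coincide. This is the passage
    from directional derivatives to one-variable ones. *)
Lemma is_derive_slice (R : realType) (V : normedModType R) (f : V -> R) (g : R -> V)
    (x : R) (v : V) (d : R) :
  (forall h, g (h + x) = h *: v + g x) -> is_derive (g x) v f d ->
  is_derive x (1 : R) (fun s => f (g s)) d.
Proof.
move=> gE [df <-].
have E : (fun h => h^-1 *: (((fun s => f (g s)) \o shift x) (h *: (1 : R)) - f (g x))) =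
         (fun h => h^-1 *: ((f \o shift (g x)) (h *: v) - f (g x))).
  by apply/funext => h /=; rewrite [h *: 1]mulr1 gE.
by split; [rewrite /derivable E|rewrite /derive E].
Qed.

Lemma for_continuous_triple (T : topologicalType) (R : realType) (f g k : T -> R) (x : T) :
  {for x, continuous f} -> {for x, continuous g} -> {for x, continuous k} ->
  {for x, continuous (fun y => (f y, g y, k y) : heis R)}.
Proof. by move=> cf cg ck; exact: (cvg_pair (cvg_pair cf cg) ck). Qed.

(** * Volume integrals: derivatives, reflection, shears and rotations *)

Section hintegral_theory.
Variable R : realType.
Implicit Types (h : heis R -> R) (q : heis R).

Lemma hintegral_eq_x h h' : ccont h -> ccont h' ->
  (forall y z, \int[lebesgue_measure]_x (h (x, y, z))%:E =
               \int[lebesgue_measure]_x (h' (x, y, z))%:E)%E ->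
  hintegral h = hintegral h'.
Proof.
move=> ch ch' E; rewrite /hintegral /Rintegral; congr fine.
apply: (etrans (ccont_int_zyx ch)); apply: (etrans _ (esym (ccont_int_zyx ch'))).
by apply: eq_integral => z _; apply: eq_integral => y _.
Qed.

Lemma hintegral_eq_y h h' : ccont h -> ccont h' ->
  (forall x z, \int[lebesgue_measure]_y (h (x, y, z))%:E =
               \int[lebesgue_measure]_y (h' (x, y, z))%:E)%E ->
  hintegral h = hintegral h'.
Proof.
move=> ch ch' E; rewrite /hintegral /Rintegral; congr fine.
apply: (etrans (ccont_int_zxy ch)); apply: (etrans _ (esym (ccont_int_zxy ch'))).
by apply: eq_integral => z _; apply: eq_integral => x _.
Qed.

Lemma hintegral_eq_z h h' : ccont h -> ccont h' ->
  (forall x y, \int[lebesgue_measure]_z (h (x, y, z))%:E =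
               \int[lebesgue_measure]_z (h' (x, y, z))%:E)%E ->
  hintegral h = hintegral h'.
Proof.
move=> ch ch' E; rewrite /hintegral /Rintegral; congr fine.
apply: (etrans (ccont_int_xyz ch)); apply: (etrans _ (esym (ccont_int_xyz ch'))).
by apply: eq_integral => -[x y] _.
Qed.

Lemma ccont0 : ccont (fun _ : heis R => 0 : R).
Proof. by split; [exact: cst_continuous|exists 0]. Qed.

Lemma hintegral0 : hintegral (fun _ : heis R => 0 : R) = 0.
Proof. by rewrite /hintegral /Rintegral integral0. Qed.

Lemma continuous_slice_x h y z : continuous h -> continuous (fun x => h (x, y, z)).
Proof.
move=> ch x; apply: (@continuous_comp _ _ _ (fun x => (x, y, z)) h); last exact: ch.
apply: for_continuous_triple; [exact: cvg_id|exact: cvg_cst|exact: cvg_cst].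
Qed.

Lemma continuous_slice_y h x z : continuous h -> continuous (fun y => h (x, y, z)).
Proof.
move=> ch y; apply: (@continuous_comp _ _ _ (fun y => (x, y, z)) h); last exact: ch.
apply: for_continuous_triple; [exact: cvg_cst|exact: cvg_id|exact: cvg_cst].
Qed.

Lemma continuous_slice_z h x y : continuous h -> continuous (fun z => h (x, y, z)).
Proof.
move=> ch z; apply: (@continuous_comp _ _ _ (fun z => (x, y, z)) h); last exact: ch.
apply: for_continuous_triple; [exact: cvg_cst|exact: cvg_cst|exact: cvg_id].
Qed.

Lemma normx_le (x y z : R) : `|x| <= `|(x, y, z)|.
Proof. by have := lexx `|(x, y, z) : heis R|; rewrite norm_heis_le => /and3P[]. Qed.

Lemma normy_le (x y z : R) : `|y| <= `|(x, y, z)|.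
Proof. by have := lexx `|(x, y, z) : heis R|; rewrite norm_heis_le => /and3P[]. Qed.

Lemma normz_le (x y z : R) : `|z| <= `|(x, y, z)|.
Proof. by have := lexx `|(x, y, z) : heis R|; rewrite norm_heis_le => /and3P[]. Qed.

(** By Fubini the integral in the direction [e] is taken first, and each of these line integrals
    vanishes by the fundamental theorem of calculus. *)
Lemma hintegral_derive h dh e : e \in [:: e_x; e_y; e_z] -> ccont h -> ccont dh ->
  (forall q, is_derive q e h (dh q)) -> hintegral dh = 0.
Proof.
move=> he [ch [M hM]] cdh dhP; rewrite -[RHS]hintegral0.
have hM0 q : forall x, `|x| <= `|q| -> M < `|x| -> h q = 0.
  by move=> x xq Mx; apply: hM; exact: lt_le_trans Mx xq.
move: he dhP; rewrite !inE => /or3P[] /eqP -> dhP.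
- apply: hintegral_eq_x => // [|y z]; first exact: ccont0.
  rewrite integral0; apply: (@integral_derivative_line R (fun x => h (x, y, z)) _ M).
  + by apply: continuous_slice_x; case: cdh.
  + move=> x; apply: (@is_derive_slice _ _ h (fun x => (x, y, z)) x e_x) => // k.
    by congr (_, _, _); rewrite /= ?[k *: 1]mulr1 ?[k *: 0]mulr0 ?add0r.
  + by move=> x; apply: hM0; exact: normx_le.
- apply: hintegral_eq_y => // [|x z]; first exact: ccont0.
  rewrite integral0; apply: (@integral_derivative_line R (fun y => h (x, y, z)) _ M).
  + by apply: continuous_slice_y; case: cdh.
  + move=> y; apply: (@is_derive_slice _ _ h (fun y => (x, y, z)) y e_y) => // k.
    by congr (_, _, _); rewrite /= ?[k *: 1]mulr1 ?[k *: 0]mulr0 ?add0r.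
  + by move=> y; apply: hM0; exact: normy_le.
- apply: hintegral_eq_z => // [|x y]; first exact: ccont0.
  rewrite integral0; apply: (@integral_derivative_line R (fun z => h (x, y, z)) _ M).
  + by apply: continuous_slice_z; case: cdh.
  + move=> z; apply: (@is_derive_slice _ _ h (fun z => (x, y, z)) z e_z) => // k.
    by congr (_, _, _); rewrite /= ?[k *: 1]mulr1 ?[k *: 0]mulr0 ?add0r.
  + by move=> z; apply: hM0; exact: normz_le.
Qed.

Definition reflz q : heis R := (cx q, cy q, - cz q).

Lemma hintegral_reflz h : ccont h -> ccont (h \o reflz) ->
  hintegral (h \o reflz) = hintegral h.
Proof.
move=> ch chr; apply: hintegral_eq_z => // x y; have [ch' [M hM]] := ch.
apply: (@integral_reflection_line R (fun z => h (x, y, z)) M).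
  exact: continuous_slice_z.
by move=> z Mz; apply: hM; exact: lt_le_trans Mz (normz_le x y z).
Qed.

(** The bound is on the left inverse because it is preimages of bounded sets that have to be
    bounded. *)
Lemma ccont_comp h (T T' : heis R -> heis R) (K : R) : continuous T -> cancel T T' ->
  0 <= K -> (forall q, `|T' q| <= K * `|q|) -> ccont h -> ccont (h \o T).
Proof.
move=> cT TK K0 T'K [ch [M hM]]; split.
  by move=> q; apply: continuous_comp; [exact: cT|exact: ch].
exists (K * M) => q Kq /=; apply: hM; rewrite ltNge; apply/negP => qM.
have := T'K (T q); rewrite TK => /(lt_le_trans Kq); rewrite ltNge => /negP; apply.
exact: ler_wpM2l.
Qed.

Lemma continuous_cx : continuous (@cx R).
Proof. by move=> q; apply: (@cvg_comp _ _ _ fst fst); [exact: cvg_fst|exact: cvg_fst]. Qed.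

Lemma continuous_cy : continuous (@cy R).
Proof. by move=> q; apply: (@cvg_comp _ _ _ fst snd); [exact: cvg_fst|exact: cvg_snd]. Qed.

Lemma continuous_cz : continuous (@cz R).
Proof. by move=> q; exact: cvg_snd. Qed.

(** The common form of shears and rotations, for which the support bound is proved once. *)
Definition linxy (a b c d : R) q : heis R :=
  (cx q * a + cy q * b, cx q * c + cy q * d, cz q).

Lemma continuous_linxy a b c d : continuous (linxy a b c d).
Proof.
have C k : continuous (fun _ : heis R => k : R) by exact: cst_continuous.
move=> q; apply: (@for_continuous_triple _ _ (fun q => cx q * a + cy q * b) (fun q => cx q * c + cy q * d) (@cz R)); last exact: continuous_cz.
  by apply: cvgD; apply: cvgM; do ?[exact: continuous_cx|exact: continuous_cy|exact: C].
by apply: cvgD; apply: cvgM; do ?[exact: continuous_cx|exact: continuous_cy|exact: C].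
Qed.

Lemma norm_linxy a b c d q : `|linxy a b c d q| <= (`|a| + `|b| + `|c| + `|d| + 1) * `|q|.
Proof.
have := lexx `|q|; rewrite norm_heis_le => /and3P[hx hy hz].
rewrite norm_heis_le /linxy /cx /cy /cz /=.
have q0 := normr_ge0 q.
have [a0 b0 c0 d0] : [/\ 0 <= `|a|, 0 <= `|b|, 0 <= `|c| & 0 <= `|d|] by [].
have ha := mulr_ge0 a0 q0; have hb := mulr_ge0 b0 q0; have hc := mulr_ge0 c0 q0.
have hd := mulr_ge0 d0 q0.
have H (u k : R) : `|u| <= `|q| -> `|u * k| <= `|k| * `|q|.
  by move=> uq; rewrite normrM mulrC ler_wpM2l.
apply/and3P; split.
- by apply: le_trans (ler_normD _ _) _; have := H _ a hx; have := H _ b hy; rewrite /cx /cy; lra.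
- by apply: le_trans (ler_normD _ _) _; have := H _ c hx; have := H _ d hy; rewrite /cx /cy; lra.
- by move: hz; rewrite /cz; lra.
Qed.

Lemma ccont_linxy a b c d a' b' c' d' h : cancel (linxy a b c d) (linxy a' b' c' d') ->
  ccont h -> ccont (h \o linxy a b c d).
Proof.
move=> K ch; have K0 : 0 <= `|a'| + `|b'| + `|c'| + `|d'| + 1 by rewrite !addr_ge0.
exact: (@ccont_comp h (linxy a b c d) (linxy a' b' c' d') (`|a'| + `|b'| + `|c'| + `|d'| + 1) (@continuous_linxy a b c d) K K0 (@norm_linxy a' b' c' d') ch).
Qed.

Lemma shear_xK a : cancel (linxy 1 a 0 1) (linxy 1 (- a) 0 1).
Proof. by move=> [[x y] z]; rewrite /linxy /cx /cy /cz /=; congr (_, _, _); ring. Qed.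

Lemma shear_yK a : cancel (linxy 1 0 a 1) (linxy 1 0 (- a) 1).
Proof. by move=> [[x y] z]; rewrite /linxy /cx /cy /cz /=; congr (_, _, _); ring. Qed.

Lemma hintegral_shear_x a h : ccont h -> hintegral (h \o linxy 1 a 0 1) = hintegral h.
Proof.
move=> ch; apply: hintegral_eq_x => //; first exact: ccont_linxy (shear_xK a) ch.
move=> y z; have [ch' [M hM]] := ch.
rewrite -(@integral_translation_line R (fun x => h (x, y, z)) M (y * a)).
- by apply: eq_integral => x _; rewrite /= /linxy /cx /cy /cz /= mulr1 mulr0 add0r mulr1.
- exact: continuous_slice_x.
- by move=> x Mx; apply: hM; exact: lt_le_trans Mx (normx_le x y z).
Qed.

Lemma hintegral_shear_y a h : ccont h -> hintegral (h \o linxy 1 0 a 1) = hintegral h.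
Proof.
move=> ch; apply: hintegral_eq_y => //; first exact: ccont_linxy (shear_yK a) ch.
move=> x z; have [ch' [M hM]] := ch.
rewrite -(@integral_translation_line R (fun y => h (x, y, z)) M (x * a)).
- by apply: eq_integral => y _; rewrite /= /linxy /cx /cy /cz /= !mulr1 mulr0 addr0 addrC.
- exact: continuous_slice_y.
- by move=> y My; apply: hM; exact: lt_le_trans My (normy_le x y z).
Qed.

Lemma ccont_rot t h : ccont h -> ccont (h \o Defs.rot t).
Proof.
have -> : Defs.rot t = linxy (cos t) (- sin t) (sin t) (cos t).
  by apply/funext => q; rewrite /Defs.rot /linxy mulrN.
apply: (@ccont_linxy _ _ _ _ (cos t) (sin t) (- sin t) (cos t)).
move=> [[x y] z]; have := cos2Dsin2 t; rewrite /linxy /cx /cy /cz /= => cs.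
congr (_, _, _); [transitivity (x * (cos t ^+ 2 + sin t ^+ 2))|transitivity (y * (cos t ^+ 2 + sin t ^+ 2))];
  by [ring|rewrite cs mulr1].
Qed.

Lemma hintegral_rot t h : ccont h -> hintegral (h \o Defs.rot t) = hintegral h.
Proof.
(* A rotation with nonzero sine is a product of three shears, each preserving [dq] by Fubini. *)
have H (c s : R) k : s != 0 -> c ^+ 2 + s ^+ 2 = 1 -> ccont k ->
    ccont (k \o linxy c (- s) s c) /\ hintegral (k \o linxy c (- s) s c) = hintegral k.
  (* For [c = cos t] and [s = sin t] this is [- tan (t / 2)], the slope of the two outer shears;
     hence the need for a nonzero sine. *)
  move=> s0 cs ck; pose a : R := (c - 1) / s.
  have as1 : s * a = c - 1 by rewrite /a mulrC divfK.
  have E : k \o linxy c (- s) s c =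
      ((k \o linxy 1 a 0 1) \o linxy 1 0 s 1) \o linxy 1 a 0 1.
    apply/funext => -[[x y] z]; rewrite /= /linxy /cx /cy /cz /=; congr (k (_, _, _)).
    - transitivity (x * (1 + s * a) + y * (a * (1 + (1 + s * a)))); last by ring.
      rewrite as1 [1 + (c - 1)]addrC subrK; congr (x * _ + y * _).
      apply: (mulfI s0); rewrite mulrA as1 mulrN -expr2.
      have -> : s ^+ 2 = 1 - c ^+ 2 by rewrite -cs addrAC subrr add0r.
      by ring.
    - transitivity (x * s + y * (1 + s * a)); last by ring.
      by rewrite as1 [1 + (c - 1)]addrC subrK.
  have c1 : ccont (k \o linxy 1 a 0 1) := ccont_linxy (shear_xK a) ck.
  have c2 : ccont ((k \o linxy 1 a 0 1) \o linxy 1 0 s 1) := ccont_linxy (shear_yK s) c1.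
  split; first by rewrite E; exact: ccont_linxy (shear_xK a) c2.
  by rewrite E hintegral_shear_x// hintegral_shear_y// hintegral_shear_x.
move=> ch; have cs := cos2Dsin2 t.
have -> : Defs.rot t = linxy (cos t) (- sin t) (sin t) (cos t).
  by apply/funext => q; rewrite /Defs.rot /linxy mulrN.
have [s0|s0] := eqVneq (sin t) 0; last exact: (H _ _ _ s0 cs ch).2.
have c0 : cos t != 0.
  by apply/eqP => c0; move: cs; rewrite s0 c0 expr0n addr0 => /esym/eqP; rewrite oner_eq0.
(* With zero sine the angle is 0 or pi modulo a full turn, and the rotation is a product of two by
   right angles, to which the shear factorisation applies. *)
have -> : h \o linxy (cos t) (- sin t) (sin t) (cos t) =
    (h \o linxy 0 (- 1) 1 0) \o linxy 0 (- - cos t) (- cos t) 0.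
  apply/funext => -[[x y] z]; rewrite /= /linxy /cx /cy /cz /= s0; congr (h (_, _, _)); ring.
have [||c1 e1] := H 0 1 h _ _ ch; [exact: oner_neq0|by rewrite expr0n add0r expr1n|].
have [||_ ->] := H 0 (- cos t) _ _ _ c1 => //; first by rewrite oppr_eq0.
by rewrite expr0n add0r sqrrN -cs s0 expr0n addr0.
Qed.

(** Rotations do not preserve the maximum norm. The factor 5 is the bound of [norm_linxy] with four
    matrix entries of absolute value at most 1. *)
Lemma norm_rot_le t q : `|q| <= 5 * `|Defs.rot t q|.
Proof.
have := @norm_linxy (cos t) (sin t) (- sin t) (cos t) (Defs.rot t q).
have -> : linxy (cos t) (sin t) (- sin t) (cos t) (Defs.rot t q) = q.
  case: q => [[x y] z]; have := cos2Dsin2 t; rewrite /Defs.rot /linxy /cx /cy /cz /= => cs.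
  congr (_, _, _); [transitivity (x * (cos t ^+ 2 + sin t ^+ 2))|transitivity (y * (cos t ^+ 2 + sin t ^+ 2))];
    by [ring|rewrite cs mulr1].
move=> /le_trans; apply; rewrite ler_wpM2r// normrN.
have c1 : `|cos t| <= 1 by rewrite ler_norml cos_geN1 cos_le1.
have s1 : `|sin t| <= 1 by rewrite ler_norml sin_geN1 sin_le1.
by lra.
Qed.

Lemma measurable_rot_pair :
  measurable_fun [set: heis (measurableTypeR R) * measurableTypeR R]
    (fun p => Defs.rot p.2 p.1 : heis (measurableTypeR R)).
Proof.
have mx : measurable_fun [set: heis (measurableTypeR R) * measurableTypeR R] (fun p => cx p.1 : R).
  by apply: (measurableT_comp (continuous_heis_measurable continuous_cx)); exact: measurable_fst.
have my : measurable_fun [set: heis (measurableTypeR R) * measurableTypeR R] (fun p => cy p.1 : R).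
  by apply: (measurableT_comp (continuous_heis_measurable continuous_cy)); exact: measurable_fst.
have mz : measurable_fun [set: heis (measurableTypeR R) * measurableTypeR R] (fun p => cz p.1 : R).
  by apply: (measurableT_comp (continuous_heis_measurable continuous_cz)); exact: measurable_fst.
have mc : measurable_fun [set: heis (measurableTypeR R) * measurableTypeR R] (fun p => cos p.2 : R).
  by apply: (measurableT_comp (continuous_measurable_fun (@continuous_cos R))); exact: measurable_snd.
have ms : measurable_fun [set: heis (measurableTypeR R) * measurableTypeR R] (fun p => sin p.2 : R).
  by apply: (measurableT_comp (continuous_measurable_fun (@continuous_sin R))); exact: measurable_snd.
apply: measurable_fun_pair => //; apply: measurable_fun_pair => //.
  by apply: measurable_funB; apply: measurable_funM.
by apply: measurable_funD; apply: measurable_funM.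
Qed.

(* Averaging over the rotations: [2 pi int W = int (int_0^2pi W (rot t q) dt) dq]. *)
Lemma hintegral_rot_average_ge0 (W : heis R -> R) : ccont W ->
  (forall q, 0 <= \int[lebesgue_measure]_(t in `[0%R, (pi *+ 2)%R]) (W (Defs.rot t q))%:E)%E ->
  0 <= hintegral W.
Proof.
move=> cW W0; have [C hC] := ccont_bounded cW; have [ctW [M hM]] := cW.
pose D : set R := `[0, pi *+ 2]%classic.
(* The indicator moves the domain of [t] into the integrand, so that Fubini applies on the full
   product. *)
pose f (p : heis (measurableTypeR R) * measurableTypeR R) : R := W (Defs.rot p.2 p.1) * \1_D p.2.
have mD : measurable (D : set (measurableTypeR R)) by exact: measurable_itv.
have fi : (@dqs R \x @lebesgue_measure R)%E.-integrable setT (EFin \o f).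
  apply: (@bounded_support_integrable _ (heis (measurableTypeR R) * measurableTypeR R)%type R
    (@dqs R \x @lebesgue_measure R)%E f (box (5 * `|M|) `*` D) C).
  - by apply: measurableX => //; exact: measurable_box.
  - have h := @product_measure1E _ _ _ _ R (@dqs R) lebesgue_measure (box (5 * `|M|)) D.
    rewrite [X in (X < _)%E]h //; last exact: measurable_box.
    apply: lte_mul_pinfty => //; last by apply: compact_finite_measure; exact: segment_compact.
    by rewrite ge0_fin_numE//; exact: dq_box.
  - apply: measurable_funM.
      exact: (measurableT_comp (continuous_heis_measurable ctW) measurable_rot_pair).
    have mI : measurable_fun [set: measurableTypeR R] (\1_D : measurableTypeR R -> R).
      exact: measurable_indic.
    by apply: (measurableT_comp mI); exact: measurable_snd.
  - move=> p; rewrite /f normrM indicE; case: (_ \in _); first by rewrite normr1 mulr1.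
    by rewrite normr0 mulr0; exact: le_trans (hC p.1).
  - move=> [q t] bp; rewrite /f /= indicE; case: (boolP (t \in D)); last by rewrite mulr0.
    rewrite inE mulr1 => tD; apply: hM; rewrite ltNge; apply/negP => rM; apply: bp; split => //=.
    apply/boxE; apply: le_trans (norm_rot_le t q) _; rewrite ler_wpM2l//.
    exact: le_trans rM (ler_norm M).
have := @Fubini _ _ _ _ _ (@dqs R) (@lebesgue_measure R) _ fi.
have -> : (\int[@dqs R]_q \int[@lebesgue_measure R]_t (EFin \o f) (q, t) =
   \int[@dqs R]_q \int[lebesgue_measure]_(t in D) (W (Defs.rot t q))%:E)%E.
  apply: eq_integral => q _; rewrite [RHS]integral_mkcond; apply: eq_integral => t _.
  by rewrite /f /= patchE indicE; case: (_ \in _); rewrite ?mulr1 ?mulr0.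
have -> : (\int[@lebesgue_measure R]_t \int[@dqs R]_q (EFin \o f) (q, t) =
   \int[@lebesgue_measure R]_(t in D) (hintegral W)%:E)%E.
  rewrite [RHS]integral_mkcond; apply: eq_integral => t _.
  rewrite /f /= patchE indicE; case: (_ \in _); last first.
    by under eq_integral do rewrite mulr0; rewrite integral0.
  under eq_integral do rewrite mulr1.
  rewrite -(hintegral_rot t cW) /hintegral /Rintegral fineK//.
  by apply: integrable_fin_num => //; apply: ccont_integrable; exact: ccont_rot.
rewrite integral_cst// => E.
have : (0 <= (hintegral W)%:E * (@lebesgue_measure R D))%E.
  by rewrite -E; apply: integral_ge0 => q _; exact: W0.
have p0 := pi_gt0 R.
rewrite /D lebesgue_measure_itv/= lte_fin.
have -> : 0 < (pi : R) *+ 2 by rewrite pmulrn_lgt0.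
by rewrite sube0 -EFinM lee_fin pmulr_lge0// pmulrn_lgt0.
Qed.

End hintegral_theory.

(** * Chain rule and symmetry of second derivatives, from partial derivatives *)

Section calculus.
Variable R : realType.
Implicit Types (f : heis R -> R) (q v : heis R).

Let basis : seq (heis R) := [:: e_x; e_y; e_z].

Lemma mean_value (g g' : R -> R) (a b : R) : (forall x : R, is_derive x 1 g (g' x)) ->
  exists2 c, `|c - a| <= `|b - a| & g b - g a = g' c * (b - a).
Proof.
move=> dg; have cg : continuous g.
  by move=> x; apply: differentiable_continuous; apply/derivable1_diffP; apply: ex_derive.
have [ab|/ltW ba] := leP a b.
- have [|c] := @MVT_segment R g g' a b ab (fun x _ => dg x); first exact: continuous_subspaceT.
  rewrite in_itv/= => /andP[ac cb] E; exists c => //.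
  by rewrite !ger0_norm ?subr_ge0// lerB.
- have [|c] := @MVT_segment R g g' b a ba (fun x _ => dg x); first exact: continuous_subspaceT.
  rewrite in_itv/= => /andP[bc ca] E; exists c; last by rewrite -opprB E -mulrN opprB.
  by rewrite distrC [X in _ <= X]distrC !ger0_norm ?subr_ge0// lerB.
Qed.

Lemma smooth_continuous f : smooth f -> continuous f.
Proof. by move=> /(_ 0%N)[]. Qed.

Lemma smooth_is_derive f e q : smooth f -> e \in basis -> is_derive q e f ('D_e f q).
Proof. by move=> /(_ 1%N)[_ /= H] /H [d _]; apply/derivableP. Qed.

Lemma smooth_derive f e : smooth f -> e \in basis -> smooth (fun q => 'D_e f q).
Proof. by move=> sf he k; have [_ /= H] := sf k.+1; have [_] := H e he. Qed.

(** Meant for intermediate points of the mean value theorem: they are picked by choice and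
    controlled only near the base point. *)
Lemma for_continuous_squeeze (T : topologicalType) (g k : T -> R) (x : T) :
  {for x, continuous k} -> (forall y, `|g y - k x| <= `|k y - k x|) -> {for x, continuous g}.
Proof.
move=> ck gk; have gx : g x = k x.
  by apply/eqP; rewrite -subr_eq0 -normr_le0; have := gk x; rewrite subrr normr0.
apply/cvgrPdist_le => e e0; rewrite gx.
move/cvgrPdist_le: ck => /(_ e e0); apply: filterS => y; rewrite distrC => h.
by rewrite distrC; exact: le_trans (gk y) h.
Qed.

(* Caratheodory form of differentiability at [q]; it makes the chain rule a product rule. *)
Lemma caratheodory f q : smooth f -> exists A B C : heis R -> R,
  [/\ forall p, f p - f q = A p * (cx p - cx q) + B p * (cy p - cy q) + C p * (cz p - cz q),
      {for q, continuous A} /\ A q = 'D_e_x f q,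
      {for q, continuous B} /\ B q = 'D_e_y f q &
      {for q, continuous C} /\ C q = 'D_e_z f q].
Proof.
move=> sf; case: q => [[x y] z].
have dx a b c : is_derive a (1 : R) (fun s => f (s, b, c)) ('D_e_x f (a, b, c)).
  apply: (@is_derive_slice _ _ f (fun s => (s, b, c)) a e_x); last first.
    by apply: smooth_is_derive; rewrite // !inE eqxx.
  by move=> h; congr (_, _, _); rewrite /= ?[h *: 1]mulr1 ?[h *: 0]mulr0 ?add0r.
have dy a b c : is_derive b (1 : R) (fun s => f (a, s, c)) ('D_e_y f (a, b, c)).
  apply: (@is_derive_slice _ _ f (fun s => (a, s, c)) b e_y); last first.
    by apply: smooth_is_derive; rewrite // !inE eqxx ?orbT.
  by move=> h; congr (_, _, _); rewrite /= ?[h *: 1]mulr1 ?[h *: 0]mulr0 ?add0r.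
have dz a b c : is_derive c (1 : R) (fun s => f (a, b, s)) ('D_e_z f (a, b, c)).
  apply: (@is_derive_slice _ _ f (fun s => (a, b, s)) c e_z); last first.
    by apply: smooth_is_derive; rewrite // !inE eqxx ?orbT.
  by move=> h; congr (_, _, _); rewrite /= ?[h *: 1]mulr1 ?[h *: 0]mulr0 ?add0r.
(* The increment from [q] to [p] is telescoped one coordinate at a time, with an intermediate point
   for each part. *)
have /choice[A hA] (p : heis R) : exists c, `|c - x| <= `|cx p - x| /\
    f (cx p, cy p, cz p) - f (x, cy p, cz p) = 'D_e_x f (c, cy p, cz p) * (cx p - x).
  by have [c h1 h2] := mean_value x (cx p) (fun a => dx a (cy p) (cz p)); exists c.
have /choice[B hB] (p : heis R) : exists c, `|c - y| <= `|cy p - y| /\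
    f (x, cy p, cz p) - f (x, y, cz p) = 'D_e_y f (x, c, cz p) * (cy p - y).
  by have [c h1 h2] := mean_value y (cy p) (fun a => dy x a (cz p)); exists c.
have /choice[C hC] (p : heis R) : exists c, `|c - z| <= `|cz p - z| /\
    f (x, y, cz p) - f (x, y, z) = 'D_e_z f (x, y, c) * (cz p - z).
  by have [c h1 h2] := mean_value z (cz p) (fun a => dz x y a); exists c.
have cA : {for (x, y, z), continuous A}.
  by apply: (@for_continuous_squeeze _ _ (@cx R)) => [|p]; [exact: continuous_cx|exact: (hA p).1].
have cB : {for (x, y, z), continuous B}.
  by apply: (@for_continuous_squeeze _ _ (@cy R)) => [|p]; [exact: continuous_cy|exact: (hB p).1].
have cC : {for (x, y, z), continuous C}.
  by apply: (@for_continuous_squeeze _ _ (@cz R)) => [|p]; [exact: continuous_cz|exact: (hC p).1].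
have Aq : A (x, y, z) = x.
  by apply/eqP; rewrite -subr_eq0 -normr_le0; have := (hA (x, y, z)).1; rewrite /cx/= subrr normr0.
have Bq : B (x, y, z) = y.
  by apply/eqP; rewrite -subr_eq0 -normr_le0; have := (hB (x, y, z)).1; rewrite /cy/= subrr normr0.
have Cq : C (x, y, z) = z.
  by apply/eqP; rewrite -subr_eq0 -normr_le0; have := (hC (x, y, z)).1; rewrite /cz/= subrr normr0.
have cst k : {for (x, y, z), continuous (fun _ : heis R => k : R)} by exact: cst_continuous.
have ccy : {for (x, y, z), continuous (@cy R)} by exact: continuous_cy.
have ccz : {for (x, y, z), continuous (@cz R)} by exact: continuous_cz.
have hx : e_x \in basis by rewrite !inE eqxx.
have hy : e_y \in basis by rewrite !inE eqxx ?orbT.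
have hz : e_z \in basis by rewrite !inE eqxx ?orbT.
exists (fun p => 'D_e_x f (A p, cy p, cz p)), (fun p => 'D_e_y f (x, B p, cz p)),
  (fun p => 'D_e_z f (x, y, C p)); split.
- move=> p; rewrite -(hA p).2 -(hB p).2 -(hC p).2; case: p => [[a b] c]; rewrite /cx /cy /cz /=; ring.
- split; last by rewrite Aq.
  apply: (@continuous_comp _ _ _ (fun p => (A p, cy p, cz p)) (fun q => 'D_e_x f q)).
    exact: (for_continuous_triple cA ccy ccz).
  exact: (smooth_continuous (smooth_derive sf hx)).
- split; last by rewrite Bq.
  apply: (@continuous_comp _ _ _ (fun p => (x, B p, cz p)) (fun q => 'D_e_y f q)).
    exact: (for_continuous_triple (cst x) cB ccz).
  exact: (smooth_continuous (smooth_derive sf hy)).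
- split; last by rewrite Cq.
  apply: (@continuous_comp _ _ _ (fun p => (x, y, C p)) (fun q => 'D_e_z f q)).
    exact: (for_continuous_triple (cst x) (cst y) cC).
  exact: (smooth_continuous (smooth_derive sf hz)).
Qed.

Lemma is_derive_cvg (g : R -> R) (t d : R) :
  is_derive t 1 g d <-> (fun h => h^-1 * (g (h + t) - g t)) @ 0^' --> d.
Proof.
have E : (fun h => h^-1 *: ((g \o shift t) (h *: (1 : R)) - g t)) =
         (fun h => h^-1 * (g (h + t) - g t)).
  by apply/funext => h /=; rewrite [h *: 1]mulr1.
split=> [[dg <-]|H]; first by rewrite /derive E; move: dg; rewrite /derivable E.
split; rewrite /derivable /derive E; first by apply/cvg_ex; exists d.
exact: cvg_lim.
Qed.

Lemma is_derive_curve f (a b c : R -> R) (t da db dc : R) : smooth f ->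
  is_derive t 1 a da -> is_derive t 1 b db -> is_derive t 1 c dc ->
  is_derive t (1 : R) (fun s => f (a s, b s, c s))
    ('D_e_x f (a t, b t, c t) * da + 'D_e_y f (a t, b t, c t) * db +
     'D_e_z f (a t, b t, c t) * dc).
Proof.
move=> sf ha hb hc; pose g s : heis R := (a s, b s, c s).
have [A [B [C [E [cA Aq] [cB Bq] [cC Cq]]]]] := @caratheodory f (g t) sf.
have cont (k : R -> R) dk : is_derive t 1 k dk -> {for t, continuous k}.
  by move=> hk; apply: differentiable_continuous; apply/derivable1_diffP; apply: ex_derive.
have cg : {for t, continuous g}.
  by apply: for_continuous_triple; apply: cont; eassumption.
have sh (D : heis R -> R) : {for g t, continuous D} -> D (g (h + t)) @[h --> 0^'] --> D (g t).
  move=> cD; have cDg : {for t, continuous (D \o g)} by apply: continuous_comp.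
  apply: (cvg_trans _ cDg); apply: (@cvg_comp _ _ _ (fun h => h + t) (D \o g) _ (nbhs t)); last exact: cvg_id.
  have H : h + t @[h --> (0 : R)] --> (0 : R) + t by apply: cvgD; [exact: cvg_id|exact: cvg_cst].
  by rewrite add0r in H; exact: cvg_within_filter H.
apply/is_derive_cvg; rewrite -Aq -Bq -Cq.
rewrite (_ : (fun h => _) = (fun h => A (g (h + t)) * (h^-1 * (a (h + t) - a t)) +
   B (g (h + t)) * (h^-1 * (b (h + t) - b t)) + C (g (h + t)) * (h^-1 * (c (h + t) - c t)))).
  apply: cvgD; [apply: cvgD|]; (apply: cvgM; [exact: sh|exact/is_derive_cvg]).
apply/funext => h; rewrite (E (g (h + t))) /cx /cy /cz /=; ring.
Qed.

(** The mean value theorem twice: along [e] for the increment of [f] in the direction [e'], then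
    along [e'] for the derivative of [f] in the direction [e]. *)
Lemma mixed_difference f e e' q (h : R) : smooth f -> e \in basis -> e' \in basis ->
  exists s t, [/\ `|s| <= `|h|, `|t| <= `|h| &
   f (q + h *: e + h *: e') - f (q + h *: e) - f (q + h *: e') + f q =
   h ^+ 2 * 'D_e' (fun p => 'D_e f p) (q + s *: e + t *: e')].
Proof.
move=> sf he he'.
have d1 k s : is_derive s (1 : R) (fun s => f (q + s *: e + k)) ('D_e f (q + s *: e + k)).
  apply: (@is_derive_slice _ _ f (fun s => q + s *: e + k) s e); last exact: smooth_is_derive.
  by move=> l; rewrite scalerDl !addrA [l *: e + q]addrC.
have d2 s t : is_derive t (1 : R) (fun t => 'D_e f (q + s *: e + t *: e'))
    ('D_e' (fun p => 'D_e f p) (q + s *: e + t *: e')).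
  apply: (@is_derive_slice _ _ (fun p => 'D_e f p) (fun t => q + s *: e + t *: e') t e').
    by move=> l; rewrite scalerDl addrCA.
  by apply: smooth_is_derive => //; exact: smooth_derive.
have [s s1 Es] := @mean_value _ _ 0 h (fun s => is_deriveB (d1 (h *: e') s) (d1 0 s)).
have [t t1 Et] := @mean_value _ _ 0 h (d2 s).
rewrite !subr0 in s1 t1; exists s, t; split => //.
move: Es Et; rewrite /= !scale0r !addr0 !subr0 => Es Et.
rewrite expr2 -mulrA [h * 'D_e' _ _]mulrC -Et mulrC.
rewrite -[RHS]Es; rewrite !fctE !addr0.
have -> : q + 0 *: e + h *: e' = q + h *: e' by rewrite scale0r addr0.
rewrite opprB scale0r addr0; ring.
Qed.

(** The second difference is symmetric in the two directions, so the two mixed derivatives agree at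
    a pair of points that tend to [q] with [h]; continuity concludes. *)
Lemma schwarz f e e' q : smooth f -> e \in basis -> e' \in basis ->
  'D_e' (fun p => 'D_e f p) q = 'D_e (fun p => 'D_e' f p) q.
Proof.
move=> sf he he'; apply/eqP; rewrite -subr_eq0 -normr_le0; apply/ler_addgt0Pr => eps eps0.
rewrite add0r.
have ne (v : heis R * heis R) (p : heis R) :
  continuous (fun st : R * R => p + st.1 *: v.1 + st.2 *: v.2 : heis R).
  move=> st; apply: cvgD; first apply: cvgD; first exact: cvg_cst.
    by apply: cvgZr_tmp; exact: cvg_fst.
  by apply: cvgZr_tmp; exact: cvg_snd.
have key (g : heis R -> R) (v : heis R * heis R) : continuous g ->
  exists2 d : R, 0 < d & forall s t : R, `|s| <= d -> `|t| <= d ->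
    `|g q - g (q + s *: v.1 + t *: v.2)| <= eps / 2.
  move=> cg; have : {for (0, 0) : R * R, continuous (g \o (fun st : R * R => q + st.1 *: v.1 + st.2 *: v.2))}.
    by apply: continuous_comp; [exact: ne|exact: cg].
  move=> /cvgrPdist_le /(_ (eps / 2)); rewrite divr_gt0// => /(_ isT) /nbhs_ballP[d /= d0 H].
  exists (d / 2); first by rewrite divr_gt0.
  move=> s t sd td; have := H (s, t); rewrite /= !scale0r !addr0; apply.
  have dd : d / 2 < d by lra.
  by split; rewrite /ball/= sub0r normrN; [exact: le_lt_trans sd dd|exact: le_lt_trans td dd].
have [d1 d10 H1] := key _ (e, e') (smooth_continuous (smooth_derive (smooth_derive sf he) he')).
have [d2 d20 H2] := key _ (e', e) (smooth_continuous (smooth_derive (smooth_derive sf he') he)).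
pose h := Num.min d1 d2; have h0 : 0 < h by rewrite lt_min d10.
have [s [t [sh th E]]] := mixed_difference q h sf he he'.
have [s' [t' [sh' th' E']]] := mixed_difference q h sf he' he.
have hd1 : `|h| <= d1 by rewrite gtr0_norm// ge_min lexx.
have hd2 : `|h| <= d2 by rewrite gtr0_norm// ge_min lexx orbT.
have EE : 'D_e' (fun p => 'D_e f p) (q + s *: e + t *: e') =
          'D_e (fun p => 'D_e' f p) (q + s' *: e' + t' *: e).
  apply: (@mulfI _ (h ^+ 2)); first by rewrite expf_neq0// gt_eqF.
  apply: (etrans (esym E)); apply: (etrans _ E').
  have -> : q + h *: e' + h *: e = q + h *: e + h *: e' by exact: addrAC.
  by move: (f (q + h *: e + h *: e')) (f (q + h *: e)) (f (q + h *: e')) (f q) => F1 F2 F3 F4; ring.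
have triangle (A B m m' : R) : m = m' -> `|A - m| <= eps / 2 -> `|B - m'| <= eps / 2 -> `|A - B| <= eps.
  move=> <- Am Bm; have -> : A - B = (A - m) - (B - m) by ring.
  by apply: le_trans (ler_normB _ _) _; rewrite [X in _ <= X](splitr eps) lerD.
exact: (triangle _ _ _ _ EE (H1 s t (le_trans sh hd1) (le_trans th hd1))
  (H2 s' t' (le_trans sh' hd2) (le_trans th' hd2))).
Qed.

Lemma is_derive_cx q v : is_derive q v (@cx R) (cx v).
Proof.
have E : (fun h => h^-1 *: ((@cx R \o shift q) (h *: v) - cx q)) @ 0^' --> cx v.
  apply: cvg_near_cst.
  near=> h; rewrite /= /cx /= addrK.
  by rewrite [h^-1 *: _]mulrA mulVf ?mul1r//; near: h; exact: nbhs_dnbhs_neq.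
by split; [apply/cvg_ex; exists (cx v)|exact: cvg_lim].
Unshelve. all: by end_near. Qed.

Lemma is_derive_cy q v : is_derive q v (@cy R) (cy v).
Proof.
have E : (fun h => h^-1 *: ((@cy R \o shift q) (h *: v) - cy q)) @ 0^' --> cy v.
  apply: cvg_near_cst.
  near=> h; rewrite /= /cy /= addrK.
  by rewrite [h^-1 *: _]mulrA mulVf ?mul1r//; near: h; exact: nbhs_dnbhs_neq.
by split; [apply/cvg_ex; exists (cy v)|exact: cvg_lim].
Unshelve. all: by end_near. Qed.

Lemma is_derive_cz q v : is_derive q v (@cz R) (cz v).
Proof.
have E : (fun h => h^-1 *: ((@cz R \o shift q) (h *: v) - cz q)) @ 0^' --> cz v.
  apply: cvg_near_cst.
  near=> h; rewrite /= /cz /= addrK.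
  by rewrite [h^-1 *: _]mulrA mulVf ?mul1r//; near: h; exact: nbhs_dnbhs_neq.
by split; [apply/cvg_ex; exists (cz v)|exact: cvg_lim].
Unshelve. all: by end_near. Qed.

End calculus.

(** * Functions supported off the axis, and null densities *)

Section off_axis.
Variables (R : realType) (S : set (heis R)).
Hypotheses (cS : compact S) (clS : closed S) (Saxis : S `<=` ~` zaxis).
Implicit Types (f h : heis R -> R) (q v e : heis R).

(** The weights are singular on the axis, so continuity is asked off it only; as [S] is closed and
    avoids the axis, vanishing outside [S] settles the rest. *)
Definition admissible h :=
  (forall q, ~ zaxis q -> continuous_at q h) /\ (forall q, ~ S q -> h q = 0).

Lemma near_notin q : ~ S q -> \near q, ~ S q.
Proof. by move=> Sq; apply: open_nbhs_nbhs; split; [exact: closed_openC|]. Qed.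

Lemma zaxis_notin q : zaxis q -> ~ S q.
Proof. by move=> qz /Saxis; apply. Qed.

Lemma admissible_ccont h : admissible h -> ccont h.
Proof.
move=> [ch h0]; split.
  move=> q; have [qz|] := pselect (zaxis q); last exact: ch.
  have Sq := zaxis_notin qz; rewrite /continuous_at (h0 q Sq).
  by apply: cvg_near_cst; apply: filterS (near_notin Sq) => p /h0.
have /compact_bounded[M [_ hM]] := cS.
exists (M + 1) => q Mq; apply: h0 => Sq.
have M1 : M < M + 1 by rewrite ltrDl.
have := hM (M + 1) M1 q Sq; rewrite /= => qM.
by have := lt_le_trans Mq qM; rewrite ltxx.
Qed.

Lemma is_derive_notin h v q : (forall p, ~ S p -> h p = 0) -> ~ S q -> is_derive q v h 0.
Proof.
move=> h0 Sq; apply: (@near_eq_is_derive _ _ _ (fun _ : heis R => 0 : R)).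
by apply: filterS (near_notin Sq) => p /h0.
Qed.

Lemma derive_notin h v q : (forall p, ~ S p -> h p = 0) -> ~ S q -> 'D_v h q = 0.
Proof. by move=> h0 Sq; apply: derive_val; exact: is_derive_notin. Qed.

(* [F] carries the support, [psi] may be singular on the axis. *)
Lemma hintegral_ibp e (psi dpsi F dF : heis R -> R) : e \in [:: e_x; e_y; e_z] ->
  (forall q, ~ zaxis q -> is_derive q e psi (dpsi q)) ->
  (forall q, ~ zaxis q -> continuous_at q psi) ->
  (forall q, ~ zaxis q -> continuous_at q dpsi) ->
  (forall q, is_derive q e F (dF q)) -> continuous F -> continuous dF ->
  (forall q, ~ S q -> F q = 0) ->
  admissible (fun q => dpsi q * F q + psi q * dF q) /\
  hintegral (fun q => dpsi q * F q + psi q * dF q) = 0.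
Proof.
move=> he dpsiP cpsi cdpsi dFP cF cdF F0.
have dF0 q : ~ S q -> dF q = 0.
  by move=> Sq; rewrite -(derive_notin e F0 Sq); apply/esym/derive_val.
have adm1 : admissible (fun q => psi q * F q).
  split=> [q qz|q Sq]; last by rewrite F0 ?mulr0.
  by apply: continuous_atM; [exact: cpsi|exact: cF].
have adm2 : admissible (fun q => dpsi q * F q + psi q * dF q).
  split=> [q qz|q Sq]; last by rewrite F0// dF0// !mulr0 addr0.
  apply: continuous_atD; apply: continuous_atM;
    by [exact: cpsi|exact: cdpsi|exact: cF|exact: cdF].
split=> //; apply: (@hintegral_derive R (fun q => psi q * F q) _ e he).
- exact: admissible_ccont.
- exact: admissible_ccont.
move=> q; have [qz|qz] := pselect (zaxis q).
  have Sq := zaxis_notin qz; rewrite F0// dF0// !mulr0 addr0.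
  by apply: is_derive_notin => // p Sp; rewrite F0 ?mulr0.
apply: (is_derive_eq (is_deriveM (dpsiP q qz) (dFP q))).
by rewrite /GRing.scale /= addrC mulrC.
Qed.

Lemma admissible_integrable h : admissible h -> (@dq R).-integrable setT (EFin \o h).
Proof. by move=> /admissible_ccont/ccont_integrable. Qed.

Lemma admissibleD h k : admissible h -> admissible k -> admissible (fun q => h q + k q).
Proof.
move=> [ch h0] [ck k0]; split=> [q qz|q Sq]; last by rewrite h0// k0// addr0.
by apply: continuous_atD; [exact: ch|exact: ck].
Qed.

Lemma admissibleZ (c : R) h : admissible h -> admissible (fun q => c * h q).
Proof.
move=> [ch h0]; split=> [q qz|q Sq]; last by rewrite h0// mulr0.
by apply: continuous_atM; [exact: continuous_at_cst|exact: ch].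
Qed.

Lemma hintegralD h k : admissible h -> admissible k ->
  hintegral (fun q => h q + k q) = hintegral h + hintegral k.
Proof. by move=> ah ak; rewrite /hintegral RintegralD//; exact: admissible_integrable. Qed.

Lemma hintegralZ (c : R) h : admissible h ->
  hintegral (fun q => c * h q) = c * hintegral h.
Proof. by move=> ah; rewrite /hintegral RintegralZl//; exact: admissible_integrable. Qed.

Lemma hintegral_ge0 h : (forall q, ~ zaxis q -> 0 <= h q) -> (forall q, zaxis q -> h q = 0) ->
  0 <= hintegral h.
Proof.
move=> h0 h0'; apply: Rintegral_ge0 => q _.
by have [/h0' ->|/h0] := pselect (zaxis q).
Qed.

Lemma eq_hintegral h k : h =1 k -> hintegral h = hintegral k.
Proof. by move=> hk; congr hintegral; exact/funext. Qed.

(** Admissibility is carried along because additivity of the integral needs integrability. *)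
Definition null h := admissible h /\ hintegral h = 0.

Lemma nullD h k : null h -> null k -> null (fun q => h q + k q).
Proof.
move=> [ah h0] [ak k0]; split; first exact: admissibleD.
by rewrite hintegralD// h0 k0 addr0.
Qed.

Lemma nullZ (c : R) h : null h -> null (fun q => c * h q).
Proof.
move=> [ah h0]; split; first exact: admissibleZ.
by rewrite hintegralZ// h0 mulr0.
Qed.

Lemma null_eq h k : admissible h -> null k -> (forall q, ~ zaxis q -> h q = k q) -> null h.
Proof.
move=> ah [[_ k0] k00] hk; split=> //; rewrite -k00; apply: eq_hintegral => q.
have [qz|/hk//] := pselect (zaxis q); have Sq := zaxis_notin qz.
by rewrite k0//; case: ah => _ ->.
Qed.

(** The mechanism of the estimates: a density that becomes pointwise nonnegative after a null
    density is added has nonnegative integral. *)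
Lemma le_hintegral_null h k : admissible h -> null k ->
  (forall q, ~ zaxis q -> 0 <= h q + k q) -> 0 <= hintegral h.
Proof.
move=> ah [ak k0] hk; have <- : hintegral (fun q => h q + k q) = hintegral h by rewrite hintegralD// k0 addr0.
apply: hintegral_ge0 => // q qz; have Sq := zaxis_notin qz.
by case: ah => _ ->//; case: ak => _ ->//; rewrite addr0.
Qed.

End off_axis.

(** * The weights [r^2] and [rho^4] *)

Section weights.
Variable R : realType.
Implicit Types (q v : heis R).

(** With the polynomials [r^2] and [rho^4] in place of [r] and [rho], all densities are rational in
    the coordinates, the functions and their derivatives, within reach of [field]. *)
Definition r2 q : R := cx q ^+ 2 + cy q ^+ 2.
Definition rho4 q : R := r2 q ^+ 2 + 16 * cz q ^+ 2.

Lemma r2_gt0 q : ~ zaxis q -> 0 < r2 q.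
Proof.
move=> qz; rewrite lt_neqAle addr_ge0 ?sqr_ge0// andbT; apply/eqP => /esym/eqP.
by rewrite /r2 paddr_eq0 ?sqr_ge0// !sqrf_eq0 => /andP[/eqP x0 /eqP y0]; apply: qz.
Qed.

Lemma rho4_gt0 q : ~ zaxis q -> 0 < rho4 q.
Proof. by move=> /r2_gt0 s0; rewrite ltr_wpDr// ?exprn_gt0// mulr_ge0// sqr_ge0. Qed.

Lemma continuous_at_coords q : [/\ continuous_at q (@cx R), continuous_at q (@cy R) & continuous_at q (@cz R)].
Proof. by split; [exact: continuous_cx|exact: continuous_cy|exact: continuous_cz]. Qed.

Lemma continuous_at_r2 q : continuous_at q r2.
Proof. by have [cx' cy' cz'] := continuous_at_coords q; rewrite /r2; continuity. Qed.

Lemma continuous_at_rho4 q : continuous_at q rho4.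
Proof.
have [cx' cy' cz'] := continuous_at_coords q; have c2 := @continuous_at_r2 q.
by rewrite /rho4; continuity.
Qed.

Lemma is_derive_r2 q v : is_derive q v r2 (2 * (cx q * cx v + cy q * cy v)).
Proof.
apply: (is_derive_eq (is_deriveD (is_deriveX 2 (is_derive_cx q v)) (is_deriveX 2 (is_derive_cy q v)))).
by rewrite /GRing.scale /= !expr1; ring.
Qed.

Lemma is_derive_rho4 q v :
  is_derive q v rho4 (4 * r2 q * (cx q * cx v + cy q * cy v) + 32 * cz q * cz v).
Proof.
apply: (is_derive_eq (is_deriveD (is_deriveX 2 (is_derive_r2 q v))
  (is_deriveM (is_derive_cst (16 : R) q v) (is_deriveX 2 (is_derive_cz q v))))).
by rewrite /GRing.scale /= !expr1; ring.
Qed.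

Lemma is_derive_div (f g : heis R -> R) q v (df dg : R) : g q != 0 -> is_derive q v f df -> is_derive q v g dg ->
  is_derive q v (fun p => f p / g p) ((df * g q - f q * dg) / g q ^+ 2 : R).
Proof.
move=> g0 Df [Dg Dg'].
have Dv : is_derive q v (fun p => (g p)^-1) (- (g q) ^- 2 *: dg).
  by split; [exact: derivableV|rewrite deriveV// Dg'].
apply: (is_derive_eq (is_deriveM Df Dv)).
by rewrite /GRing.scale /=; field.
Qed.

End weights.

(** * The magnetic Wirtinger inequality on a circle *)

Section wirtinger.
Variable R : realType.

Lemma cos_sin_int2pi (n : int) :
  cos (n%:~R * (pi *+ 2) : R) = 1 /\ sin (n%:~R * (pi *+ 2) : R) = 0.
Proof.
have H (k : nat) : cos (k%:R * (pi *+ 2) : R) = 1 /\ sin (k%:R * (pi *+ 2) : R) = 0.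
  elim: k => [|k [IHc IHs]]; first by rewrite mul0r cos0 sin0.
  have c2 : cos (pi *+ 2 : R) = 1 by rewrite cos2pi.
  have s2 : sin (pi *+ 2 : R) = 0 by rewrite mulr2n sinD sinpi mul0r mulr0 addr0.
  have E : k.+1%:R * (pi *+ 2) = k%:R * (pi *+ 2) + pi *+ 2 :> R by rewrite -natr1 mulrDl mul1r.
  rewrite E (cosD (k%:R * _) (pi *+ 2)) (sinD (k%:R * _) (pi *+ 2)) IHc IHs c2.
  by split; [ring|rewrite mul0r mul1r add0r].
case: n => k; first exact: H.
by rewrite NegzE mulrNz mulNr cosN sinN; have [-> ->] := H k.+1; rewrite oppr0.
Qed.

Lemma Rintegral_continuous_le (F G : R -> R) (a b : R) :
  {in `[a, b], continuous F} -> {in `[a, b], continuous G} ->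
  {in `[a, b], forall t, F t <= G t} ->
  \int[lebesgue_measure]_(t in `[a, b]) F t <= \int[lebesgue_measure]_(t in `[a, b]) G t.
Proof.
move=> cF cG FG; apply: le_Rintegral => //.
- apply: continuous_compact_integrable; first exact: segment_compact.
  by apply: continuous_in_subspaceT => t; rewrite inE; exact: cF.
- apply: continuous_compact_integrable; first exact: segment_compact.
  by apply: continuous_in_subspaceT => t; rewrite inE; exact: cG.
Qed.

(* With [psi = p - e^(-i n t) p(0)], which vanishes at both ends, the form splits into a null
   Lagrangian and [|psi' + i alpha psi|^2 - gamma^2 |psi|^2]; the latter is compared with
   the solution [h = k tan (k (t - pi))] of the Riccati equation [h' = h^2 + k^2], [k < 1/2]. *)
Lemma magnetic_wirtinger (alpha gamma : R) (n : int) (p q dp dq : R -> R) :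
  alpha = n%:~R + gamma -> `|gamma| <= 1 / 2 ->
  (forall t : R, is_derive t 1 p (dp t)) -> (forall t : R, is_derive t 1 q (dq t)) ->
  continuous dp -> continuous dq -> p (pi *+ 2) = p 0 -> q (pi *+ 2) = q 0 ->
  (0 <= \int[lebesgue_measure]_(t in `[0%R, (pi *+ 2)%R])
    ((dp t - alpha * q t) ^+ 2 + (dq t + alpha * p t) ^+ 2 - gamma ^+ 2 * (p t ^+ 2 + q t ^+ 2))%:E)%E.
Proof.
move=> alphaE g12 Dp Dq cdp cdq p2 q2.
have pi0 := pi_gt0 R; set L : R := pi *+ 2; have L0 : 0 < L by rewrite /L pmulrn_lgt0.
pose nu : R := n%:~R.
have cont (k dk : R -> R) : (forall t : R, is_derive t 1 k (dk t)) -> continuous k.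
  by move=> hk t; apply: differentiable_continuous; apply/derivable1_diffP; apply: ex_derive.
have cp := cont _ _ Dp; have cq := cont _ _ Dq.
(* [w = w1 + i w2 = e^(- i n t) (p + i q)(0)] satisfies [w' + i alpha w = i gamma w], so it gives
   equality, and it has period 2 pi because [n] is an integer. *)
pose w1 t := cos (nu * t) * p 0 + sin (nu * t) * q 0.
pose w2 t := cos (nu * t) * q 0 - sin (nu * t) * p 0.
have Dnu (k t : R) : is_derive t (1 : R) (fun t : R => k * t) k.
  by apply: is_derive_eq; rewrite ?scaler0 ?addr0 ?add0r; exact: mulr1.
have Dc (t : R) : is_derive t (1 : R) (fun t => cos (nu * t)) (- sin (nu * t) * nu).
  exact: (@is_derive1_comp R cos (fun t => nu * t) t _ _ (is_derive_cos _) (Dnu nu t)).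
have Ds (t : R) : is_derive t (1 : R) (fun t => sin (nu * t)) (cos (nu * t) * nu).
  exact: (@is_derive1_comp R sin (fun t => nu * t) t _ _ (is_derive_sin _) (Dnu nu t)).
have Dw1 (t : R) : is_derive t (1 : R) w1 (nu * w2 t).
  apply: (is_derive_eq (is_deriveD (is_deriveM (Dc t) (is_derive_cst (p 0) t 1)) (is_deriveM (Ds t) (is_derive_cst (q 0) t 1)))).
  by rewrite /w2 /GRing.scale /=; ring.
have Dw2 (t : R) : is_derive t (1 : R) w2 (- nu * w1 t).
  apply: (is_derive_eq (is_deriveB (is_deriveM (Dc t) (is_derive_cst (q 0) t 1)) (is_deriveM (Ds t) (is_derive_cst (p 0) t 1)))).
  by rewrite /w1 /GRing.scale /=; ring.
pose a t := p t - w1 t; pose b t := q t - w2 t.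
have Da (t : R) : is_derive t (1 : R) a (dp t - nu * w2 t) by exact: is_deriveB.
have Db (t : R) : is_derive t (1 : R) b (dq t - - nu * w1 t) by exact: is_deriveB.
have [c2pi s2pi] := cos_sin_int2pi n; rewrite -/nu -/L in c2pi s2pi.
have a0 : a 0 = 0 by rewrite /a /w1 mulr0 cos0 sin0 mul1r mul0r addr0 subrr.
have b0 : b 0 = 0 by rewrite /b /w2 mulr0 cos0 sin0 mul1r mul0r subr0 subrr.
have aL : a L = 0 by rewrite /a /w1 c2pi s2pi mul1r mul0r addr0 p2 subrr.
have bL : b L = 0 by rewrite /b /w2 c2pi s2pi mul1r mul0r subr0 q2 subrr.
have cw1 := cont _ _ Dw1; have cw2 := cont _ _ Dw2; have ca := cont _ _ Da; have cb := cont _ _ Db.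
pose V t := (dp t - alpha * q t) ^+ 2 + (dq t + alpha * p t) ^+ 2 - gamma ^+ 2 * (p t ^+ 2 + q t ^+ 2).
pose B t := a t ^+ 2 + b t ^+ 2.
have ck (k : R) : continuous (fun _ : R => k) by exact: cst_continuous.
have cpt t : continuous_at t p by exact: cp.
have cqt t : continuous_at t q by exact: cq.
have cdpt t : continuous_at t dp by exact: cdp.
have cdqt t : continuous_at t dq by exact: cdq.
have cat t : continuous_at t a by exact: ca.
have cbt t : continuous_at t b by exact: cb.
have cw1t t : continuous_at t w1 by exact: cw1.
have cw2t t : continuous_at t w2 by exact: cw2.
have cB : continuous B by move=> t; rewrite /B; continuity.
have cV : continuous V by move=> t; rewrite /V; continuity.
have iV : lebesgue_measure.-integrable `[0, L] (EFin \o V).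
  by apply: continuous_compact_integrable; [exact: segment_compact|exact: continuous_subspaceT].
set JV := \int[lebesgue_measure]_(t in `[0, L]) V t.
set JB := \int[lebesgue_measure]_(t in `[0, L]) B t.
have JB0 : 0 <= JB by apply: Rintegral_ge0 => t _; rewrite addr_ge0 ?sqr_ge0.
suff : 0 <= JV.
  by rewrite -lee_fin /JV /Rintegral fineK// integrable_fin_num.
have key (k : R) : 0 < k -> k < 1 / 2 -> (k ^+ 2 - 1 / 4) * JB <= JV.
  move=> k0 k12.
  (* [k < 1 / 2] keeps [k (t - pi)] strictly between [- pi / 2] and [pi / 2] up to both ends; at
     [k = 1 / 2] the tangent would blow up there. *)
  have cpos (t : R) : t \in `[0, L] -> 0 < cos (k * (t - pi)).
    rewrite in_itv/= => /andP[t0 tL]; apply: cos_gt0_pihalf; rewrite -ltr_norml normrM gtr0_norm//.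
    have : `|t - pi| <= pi by rewrite ler_norml; apply/andP; split; rewrite /L in tL; lra.
    move=> h; apply: (@le_lt_trans _ _ (k * pi)); first by rewrite ler_pM2l.
    have -> : pi / 2 = 1 / 2 * pi :> R by field.
    by rewrite ltr_pM2r.
  pose h t := k * tan (k * (t - pi)).
  pose dh t := k ^+ 2 + h t ^+ 2.
  have Dh (t : R) : t \in `[0, L] -> is_derive t (1 : R) h (dh t).
    move=> /cpos ct; have Dl : is_derive t (1 : R) (fun t => k * (t - pi)) k.
      apply: (is_derive_eq (is_deriveM (is_derive_cst k t 1) (is_deriveB (is_derive_id t 1) (is_derive_cst pi t 1)))).
      by rewrite /GRing.scale /=; ring.
    have c0 : cos (k * (t - pi)) != 0 by rewrite gt_eqF.
    have Dt := @is_derive1_comp R tan (fun t => k * (t - pi)) t _ _ (is_derive_tan c0) Dl.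
    apply: (is_derive_eq (is_deriveM (is_derive_cst k t 1) Dt)).
    rewrite /dh /h /tan /GRing.scale /=.
    have : sin (k * (t - pi)) ^+ 2 = 1 - cos (k * (t - pi)) ^+ 2 by rewrite sin2cos2.
    move=> E; rewrite [RHS](_ : _ = k ^+ 2 * (cos (k * (t - pi)) ^+ 2 + sin (k * (t - pi)) ^+ 2) / cos (k * (t - pi)) ^+ 2).
      by rewrite cos2Dsin2; field.
    by field.
  have ch (t : R) : t \in `[0, L] -> {for t, continuous h}.
    by move=> /Dh H; apply: differentiable_continuous; apply/derivable1_diffP; apply: ex_derive.
  (* With [psi = a + i b], the first term differentiates to the cross terms of [w] and [psi], the
     second brings in the Riccati equation. Both vanish at the ends, where [psi] does. *)
  pose K t := 2 * gamma * (b t * w1 t - a t * w2 t) - h t * (a t * a t + b t * b t).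
  pose dK t := 2 * gamma * ((dq t - - nu * w1 t) * w1 t + b t * (nu * w2 t)
       - ((dp t - nu * w2 t) * w2 t + a t * (- nu * w1 t)))
     - (dh t * (a t * a t + b t * b t) + h t * (2 * a t * (dp t - nu * w2 t) + 2 * b t * (dq t - - nu * w1 t))).
  have DK (t : R) : t \in `[0, L] -> is_derive t (1 : R) K (dK t).
    move=> tL; apply: (is_derive_eq (is_deriveB
      (is_deriveM (is_derive_cst (2 * gamma) t 1) (is_deriveB (is_deriveM (Db t) (Dw1 t)) (is_deriveM (Da t) (Dw2 t))))
      (is_deriveM (Dh t tL) (is_deriveD (is_deriveM (Da t) (Da t)) (is_deriveM (Db t) (Db t)))))).
    by rewrite !fctE /dK /GRing.scale /=; ring.
  have cK (t : R) : t \in `[0, L] -> {for t, continuous K}.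
    by move=> /DK H; apply: differentiable_continuous; apply/derivable1_diffP; apply: ex_derive.
  have cdK (t : R) : t \in `[0, L] -> continuous_at t dK.
    move=> tL; have cht : continuous_at t h := ch t tL.
    by rewrite /dK /dh; continuity.
  have JK : \int[lebesgue_measure]_(t in `[0, L]) dK t = 0.
    rewrite /Rintegral (@continuous_FTC2 R dK K)//.
    - have KL : K L = 0 by rewrite /K aL bL; ring.
      have K0 : K 0 = 0 by rewrite /K a0 b0; ring.
      by rewrite KL K0 subee.
    - by apply: continuous_in_subspaceT => t; rewrite inE; exact: cdK.
    - have L0' : 0 <= L by exact: ltW.
      split.
      + move=> t; rewrite in_itv/= => /andP[t0 tL]; apply: (@ex_derive _ _ _ _ _ _ _ (DK t _)).
        by rewrite in_itv/= !ltW.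
      + by apply: cvg_at_right_filter; apply: cK; rewrite in_itv/= lexx.
      + by apply: cvg_at_left_filter; apply: cK; rewrite in_itv/= lexx L0'.
    - move=> t; rewrite in_itv/= => /andP[t0 tL]; rewrite derive1E.
      by apply: (@derive_val _ _ _ _ _ _ _ (DK t _)); rewrite in_itv/= !ltW.
  have iB : lebesgue_measure.-integrable `[0, L] (EFin \o B).
    by apply: continuous_compact_integrable; [exact: segment_compact|exact: continuous_subspaceT].
  have idK : lebesgue_measure.-integrable `[0, L] (EFin \o dK).
    apply: continuous_compact_integrable; first exact: segment_compact.
    by apply: continuous_in_subspaceT => t; rewrite inE; exact: cdK.
  have ikB : lebesgue_measure.-integrable `[0, L] (EFin \o (fun t => (k ^+ 2 - 1 / 4) * B t)).
    apply: continuous_compact_integrable; first exact: segment_compact.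
    by apply: continuous_subspaceT => t; apply: continuous_atM; [exact: continuous_at_cst|exact: cB].
  have -> : (k ^+ 2 - 1 / 4) * JB = \int[lebesgue_measure]_(t in `[0, L]) (dK t + (k ^+ 2 - 1 / 4) * B t).
    by rewrite RintegralD// JK add0r RintegralZl.
  apply: Rintegral_continuous_le.
  - by move=> t tL; apply: continuous_atD; [exact: cdK|apply: continuous_atM; [exact: continuous_at_cst|exact: cB]].
  - by move=> t _; exact: cV.
  move=> t _.
  have pE : p t = a t + w1 t by rewrite /a subrK.
  have qE : q t = b t + w2 t by rewrite /b subrK.
  have g2 : gamma ^+ 2 <= 1 / 4.
    by rewrite -real_normK ?num_real// (_ : 1 / 4 = (1 / 2) ^+ 2 :> R); [rewrite lerXn2r ?nnegrE|field].
  have B0 : 0 <= B t by rewrite addr_ge0 ?sqr_ge0.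
  have gB := ler_wpM2r B0 g2.
  have S1 := sqr_ge0 (dp t - nu * w2 t - alpha * b t + h t * a t).
  have S2 := sqr_ge0 (dq t - - nu * w1 t + alpha * a t + h t * b t).
  rewrite /V pE qE -subr_ge0.
  (* The difference of the two integrands is [(1 / 4 - gamma^2) |psi|^2 + |psi' + i alpha psi + h
     psi|^2]. *)
  have : 0 <= (1 / 4 * B t - gamma ^+ 2 * B t) + (dp t - nu * w2 t - alpha * b t + h t * a t) ^+ 2 +
     (dq t - - nu * w1 t + alpha * a t + h t * b t) ^+ 2 by lra.
  move=> H; apply: (le_trans H); rewrite le_eqVlt; apply/orP; left; apply/eqP.
  rewrite /dK /dh /B alphaE -/nu; ring.
(* For [k = 1 / 2 - d] one has [k^2 - 1 / 4 = d^2 - d], so the loss is at most [d JB <= e];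
   [d <= 1 / 4] keeps [k] positive, and [JB + 1] makes the division safe. *)
apply/ler_addgt0Pr => e e0; set d := Num.min (1 / 4) (e / (JB + 1)).
have JB1 : 0 < JB + 1 by lra.
have d0 : 0 < d by rewrite lt_min; apply/andP; split; [lra|rewrite divr_gt0].
have d4 : d <= 1 / 4 by rewrite ge_min lexx.
have de : d * (JB + 1) <= e by rewrite -ler_pdivlMr// ge_min lexx orbT.
have k1 : 0 < 1 / 2 - d by lra.
have k2 : 1 / 2 - d < 1 / 2 by lra.
have := key _ k1 k2; have : 0 <= d * JB by rewrite mulr_ge0// ltW.
have : 0 <= d ^+ 2 * JB by rewrite mulr_ge0// sqr_ge0.
by nra.
Qed.

End wirtinger.

(** * Pointwise sums of squares *)

Section pointwise.
Variable R : realType.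

(* Here [s = r^2], [N = rho^4], [A + i A'] is [r R u] and [P + i P'] is [d_phi u]. Up to null terms
   the difference is [s/N] times the squares of [r R u + t b + u] and [b - t r R u], where
   [t = 4 z / r^2] and [b] is [r (Phi u + i n / r u)]. *)
Lemma hardy_square (s z A A' P P' fz gz f g alpha gamma n N : R) :
  0 < s -> alpha = n + gamma ->
  N = s ^+ 2 + 16 * z ^+ 2 ->
  0 <= (A ^+ 2 + A' ^+ 2 + (P + s / 2 * fz - alpha * g) ^+ 2 + (P' + s / 2 * gz + alpha * f) ^+ 2) / s
       - s / N * (f ^+ 2 + g ^+ 2) - gamma ^+ 2 * ((f ^+ 2 + g ^+ 2) / s)
       - 2 * gamma * (((P' + s / 2 * gz) * f - (P + s / 2 * fz) * g) / s + n * ((f ^+ 2 + g ^+ 2) / s))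
       + 2 * (s / N * (f * (A + 2 * z * fz) + g * (A' + 2 * z * gz) + (f ^+ 2 + g ^+ 2)))
       + 2 * (4 * z / N * (f * P + g * P')).
Proof.
move=> s0 -> NE; have N0 : 0 < N by rewrite NE ltr_wpDr ?exprn_gt0// mulr_ge0// sqr_ge0.
set t := 4 * z / s; set b := P + s / 2 * fz - n * g; set b' := P' + s / 2 * gz + n * f.
have : 0 <= s / N * ((A + t * b + f) ^+ 2 + (A' + t * b' + g) ^+ 2 + (b - t * A) ^+ 2 + (b' - t * A') ^+ 2).
  by apply: mulr_ge0; [rewrite divr_ge0 ?ltW|rewrite !addr_ge0 ?sqr_ge0].
move=> H; apply: (le_trans H); rewrite le_eqVlt; apply/orP; left; apply/eqP.
rewrite /b /b' /t NE; field; rewrite -NE; apply/andP; split; exact: lt0r_neq0.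
Qed.

(** Here [b] is only the vertical part [r^2 / 2 d_z u]: the angular square and the cross term are
    subtracted beforehand. Then [r R u + t b] is the pure dilation derivative, and no rotation term
    is left to integrate away. *)
Lemma hardy_square_even (s z A A' P P' fz gz f g alpha N : R) :
  0 < s ->
  N = s ^+ 2 + 16 * z ^+ 2 ->
  0 <= (A ^+ 2 + A' ^+ 2 + (P + s / 2 * fz - alpha * g) ^+ 2 + (P' + s / 2 * gz + alpha * f) ^+ 2) / s
       - s / N * (f ^+ 2 + g ^+ 2) - ((P - alpha * g) ^+ 2 + (P' + alpha * f) ^+ 2) / s
       - ((P - alpha * g) * fz + (P' + alpha * f) * gz)
       + 2 * (s / N * (f * (A + 2 * z * fz) + g * (A' + 2 * z * gz) + (f ^+ 2 + g ^+ 2))).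
Proof.
move=> s0 NE; have N0 : 0 < N by rewrite NE ltr_wpDr ?exprn_gt0// mulr_ge0// sqr_ge0.
set t := 4 * z / s; set b := s / 2 * fz; set b' := s / 2 * gz.
have : 0 <= s / N * ((A + t * b + f) ^+ 2 + (A' + t * b' + g) ^+ 2 + (b - t * A) ^+ 2 + (b' - t * A') ^+ 2).
  by apply: mulr_ge0; [rewrite divr_ge0 ?ltW|rewrite !addr_ge0 ?sqr_ge0].
move=> H; apply: (le_trans H); rewrite le_eqVlt; apply/orP; left; apply/eqP.
rewrite /b /b' /t NE; field; rewrite -NE; apply/andP; split; exact: lt0r_neq0.
Qed.

(* This value of [k] minimises the discriminant of the form. *)
Lemma eigen_form_ge0 (t e e' f g beta gamma k : R) : gamma ^+ 2 <= 1 / 4 -> gamma ^+ 2 <= beta ^+ 2 ->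
  k = - beta / (1 + beta ^+ 2 - gamma ^+ 2) ->
  0 <= (1 - k ^+ 2) * (e ^+ 2 + e' ^+ 2) + 2 * t * (beta + k) * (e' * f - e * g)
       + (beta ^+ 2 - gamma ^+ 2) * t ^+ 2 * (f ^+ 2 + g ^+ 2).
Proof.
move=> g4 gb kE; set D := 1 + beta ^+ 2 - gamma ^+ 2.
have D0 : 0 < D by rewrite /D; lra.
(* This gives [|k| < 1]: since [gamma^2 <= 1 / 4], [D - |beta|] is at least
   [(|beta| - 1 / 2)^2 + 1 / 2]. *)
have bD : beta ^+ 2 < D ^+ 2.
  have h1 := sqr_ge0 (beta - 1 / 2); have h2 := sqr_ge0 (beta + 1 / 2).
  have l1 : beta < D by rewrite /D; nra.
  have l2 : - beta < D by rewrite /D; nra.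
  by have : 0 < (D - beta) * (D + beta) by [apply: mulr_gt0; lra|]; nra.
have a0 : 0 < 1 - k ^+ 2.
  rewrite kE -/D; have -> : 1 - (- beta / D) ^+ 2 = (D ^+ 2 - beta ^+ 2) / D ^+ 2.
    by field; exact: lt0r_neq0.
  by rewrite divr_gt0 ?exprn_gt0//; lra.
have disc : 0 <= (1 - k ^+ 2) * (beta ^+ 2 - gamma ^+ 2) - (beta + k) ^+ 2.
  rewrite kE -/D; have -> : (1 - (- beta / D) ^+ 2) * (beta ^+ 2 - gamma ^+ 2) - (beta + - beta / D) ^+ 2 =
     (beta ^+ 2 - gamma ^+ 2) * (1 - gamma ^+ 2) / D.
    rewrite /D; field; rewrite -/D; exact: lt0r_neq0.
  apply: divr_ge0; last exact: ltW.
  by apply: mulr_ge0; lra.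
(* After multiplication by [1 - k^2 > 0] the form is two squares plus the reduced determinant times
   [t^2 |u|^2]. *)
rewrite -(pmulr_rge0 _ a0).
have : 0 <= ((1 - k ^+ 2) * e' + t * (beta + k) * f) ^+ 2 + ((1 - k ^+ 2) * e - t * (beta + k) * g) ^+ 2
   + t ^+ 2 * (f ^+ 2 + g ^+ 2) * ((1 - k ^+ 2) * (beta ^+ 2 - gamma ^+ 2) - (beta + k) ^+ 2).
  rewrite addr_ge0//; first by rewrite addr_ge0// sqr_ge0.
  by apply: mulr_ge0 => //; rewrite mulr_ge0 ?sqr_ge0// addr_ge0// sqr_ge0.
move=> H; apply: (le_trans H); rewrite le_eqVlt; apply/orP; left; apply/eqP; ring.
Qed.

(** Adding [i k E u] to the component across the gradient of [rho] produces the Jacobian, [2 k beta]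
    times the dilation density (whence the coefficient [2 + 2 k beta]), and terms that are collected
    in the form of [eigen_form_ge0]. *)
Lemma hardy_square_eigen (s z A A' fz gz f g n alpha beta gamma k N : R) :
  0 < s -> gamma ^+ 2 <= 1 / 4 -> gamma ^+ 2 <= beta ^+ 2 -> beta = alpha + n ->
  k = - beta / (1 + beta ^+ 2 - gamma ^+ 2) ->
  N = s ^+ 2 + 16 * z ^+ 2 ->
  0 <= (A ^+ 2 + A' ^+ 2 + (- (n * g) + s / 2 * fz - alpha * g) ^+ 2 + (n * f + s / 2 * gz + alpha * f) ^+ 2) / s
       - s / N * (f ^+ 2 + g ^+ 2) - gamma ^+ 2 * ((f ^+ 2 + g ^+ 2) / s * (1 - s ^+ 2 / N))
       + k * (gz * A - fz * A' + (gz * f - fz * g))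
       + (2 + 2 * k * beta) * (s / N * (f * (A + 2 * z * fz) + g * (A' + 2 * z * gz) + (f ^+ 2 + g ^+ 2))).
Proof.
move=> s0 g4 gb bE kE NE; have N0 : 0 < N by rewrite NE ltr_wpDr ?exprn_gt0// mulr_ge0// sqr_ge0.
set t := 4 * z / s; set b := s / 2 * fz - beta * g; set b' := s / 2 * gz + beta * f.
set e := A + 2 * z * fz + f; set e' := A' + 2 * z * gz + g.
have F0 := eigen_form_ge0 t e e' f g g4 gb kE.
have : 0 <= s / N * ((b - t * A - k * e') ^+ 2 + (b' - t * A' + k * e) ^+ 2 +
  ((1 - k ^+ 2) * (e ^+ 2 + e' ^+ 2) + 2 * t * (beta + k) * (e' * f - e * g)
       + (beta ^+ 2 - gamma ^+ 2) * t ^+ 2 * (f ^+ 2 + g ^+ 2))).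
  by apply: mulr_ge0; [rewrite divr_ge0 ?ltW|rewrite addr_ge0// addr_ge0// sqr_ge0].
move=> H; apply: (le_trans H); rewrite le_eqVlt; apply/orP; left; apply/eqP.
have -> : alpha = beta - n by rewrite bE addrK.
rewrite /e /e' /b /b' /t NE; field; rewrite -NE; apply/andP; split; exact: lt0r_neq0.
Qed.

End pointwise.

(** * Densities whose integral vanishes *)

Section null_integrals.
Variables (R : realType) (S : set (heis R)) (f g : heis R -> R).
Hypotheses (cS : compact S) (clS : closed S) (Saxis : S `<=` ~` zaxis).
Hypotheses (sf : smooth f) (sg : smooth g).
Hypotheses (f0 : forall q, ~ S q -> f q = 0) (g0 : forall q, ~ S q -> g q = 0).
Implicit Types (q v e : heis R).

Let hx : e_x \in [:: @e_x R; e_y; e_z]. Proof. by rewrite !inE eqxx. Qed.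
Let hy : e_y \in [:: @e_x R; e_y; e_z]. Proof. by rewrite !inE eqxx orbT. Qed.
Let hz : e_z \in [:: @e_x R; e_y; e_z]. Proof. by rewrite !inE eqxx !orbT. Qed.

Let fx q : R := 'D_e_x f q.
Let fy q : R := 'D_e_y f q.
Let fz q : R := 'D_e_z f q.
Let gx q : R := 'D_e_x g q.
Let gy q : R := 'D_e_y g q.
Let gz q : R := 'D_e_z g q.

Let ctf q : continuous_at q f. Proof. exact: smooth_continuous. Qed.
Let ctg q : continuous_at q g. Proof. exact: smooth_continuous. Qed.
Let ctfx q : continuous_at q fx. Proof. exact: (smooth_continuous (smooth_derive sf hx)). Qed.
Let ctfy q : continuous_at q fy. Proof. exact: (smooth_continuous (smooth_derive sf hy)). Qed.
Let ctfz q : continuous_at q fz. Proof. exact: (smooth_continuous (smooth_derive sf hz)). Qed.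
Let ctgx q : continuous_at q gx. Proof. exact: (smooth_continuous (smooth_derive sg hx)). Qed.
Let ctgy q : continuous_at q gy. Proof. exact: (smooth_continuous (smooth_derive sg hy)). Qed.
Let ctgz q : continuous_at q gz. Proof. exact: (smooth_continuous (smooth_derive sg hz)). Qed.
Let ctx q : continuous_at q (@cx R). Proof. exact: continuous_cx. Qed.
Let cty q : continuous_at q (@cy R). Proof. exact: continuous_cy. Qed.
Let ctz q : continuous_at q (@cz R). Proof. exact: continuous_cz. Qed.
Let ctr2 q : continuous_at q (@r2 R). Proof. exact: continuous_at_r2. Qed.
Let ctrho4 q : continuous_at q (@rho4 R). Proof. exact: continuous_at_rho4. Qed.

Let half_sq q := (f q ^+ 2 + g q ^+ 2) / 2.

Let is_derive_half_sq e q : e \in [:: e_x; e_y; e_z] ->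
  is_derive q e half_sq (f q * 'D_e f q + g q * 'D_e g q).
Proof.
move=> he; have Df := smooth_is_derive q sf he; have Dg := smooth_is_derive q sg he.
apply: (is_derive_eq (is_deriveM (is_deriveD (is_deriveX 2 Df) (is_deriveX 2 Dg))
  (is_derive_cst (2^-1 : R) q e))).
by rewrite /GRing.scale /= !expr1; field.
Qed.

Let half_sq0 q : ~ S q -> half_sq q = 0.
Proof. by move=> Sq; rewrite /half_sq f0// g0// expr0n /= addr0 mul0r. Qed.

Let ct_half_sq : continuous half_sq.
Proof. by move=> q; rewrite /half_sq; continuity. Qed.

Lemma half_sq_ibp e (psi dpsi : heis R -> R) : e \in [:: e_x; e_y; e_z] ->
  (forall q, ~ zaxis q -> is_derive q e psi (dpsi q)) ->
  (forall q, ~ zaxis q -> continuous_at q psi) ->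
  (forall q, ~ zaxis q -> continuous_at q dpsi) ->
  let I q := dpsi q * half_sq q + psi q * (f q * 'D_e f q + g q * 'D_e g q) in
  null S I.
Proof.
move=> he Dpsi cpsi cdpsi; apply: (hintegral_ibp cS clS Saxis he Dpsi cpsi cdpsi).
- by move=> q; exact: is_derive_half_sq.
- exact: ct_half_sq.
- have cf' q : continuous_at q (fun q => 'D_e f q) by exact: (smooth_continuous (smooth_derive sf he)).
  have cg' q : continuous_at q (fun q => 'D_e g q) by exact: (smooth_continuous (smooth_derive sg he)).
  by move=> q; apply: continuous_atD; apply: continuous_atM.
- exact: half_sq0.
Qed.

Lemma coordE :
  ((cx (@e_x R) = 1) * (cy (@e_x R) = 0) * (cz (@e_x R) = 0) *
   (cx (@e_y R) = 0) * (cy (@e_y R) = 1) * (cz (@e_y R) = 0) *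
   (cx (@e_z R) = 0) * (cy (@e_z R) = 0) * (cz (@e_z R) = 1))%type.
Proof. by []. Qed.

Let dw q v : R := (2 * (cx q * cx v + cy q * cy v) * rho4 q
   - r2 q * (4 * r2 q * (cx q * cx v + cy q * cy v) + 32 * cz q * cz v)) / rho4 q ^+ 2.

Let is_derive_w q v : ~ zaxis q -> is_derive q v (fun p => r2 p / rho4 p) (dw q v).
Proof.
move=> qz; apply: is_derive_div; first by rewrite lt0r_neq0// rho4_gt0.
- exact: is_derive_r2.
- exact: is_derive_rho4.
Qed.

Let ct_w q : ~ zaxis q -> continuous_at q (fun p => r2 p / rho4 p).
Proof. by move=> qz; continuity; rewrite lt0r_neq0// rho4_gt0. Qed.

Let ct_dw q v : ~ zaxis q -> continuous_at q (fun p => dw p v).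
Proof. by move=> qz; rewrite /dw; continuity; rewrite expf_neq0// lt0r_neq0// rho4_gt0. Qed.

(** The field [(x, y, 2 z)] generates the dilations. It has divergence 4 and the weight
    [r^2 / rho^4] has degree -2, so the weighted field has divergence [2 r^2 / rho^4]; applied to
    [|u|^2 / 2], this yields the last term. *)
Definition dilation_null q : R := r2 q / rho4 q *
  (f q * ((cx q * fx q + cy q * fy q) + 2 * cz q * fz q) +
   g q * ((cx q * gx q + cy q * gy q) + 2 * cz q * gz q) + (f q ^+ 2 + g q ^+ 2)).

Lemma dilation_nullP : null S dilation_null.
Proof.
have adm : admissible S dilation_null.
  split=> [q qz|q Sq]; last by rewrite /dilation_null f0// g0//; ring.
  by rewrite /dilation_null; continuity; rewrite lt0r_neq0// rho4_gt0.
have [|||a1 i1] := @half_sq_ibp e_x (fun p => cx p * (r2 p / rho4 p))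
   (fun p => cx p * dw p e_x + r2 p / rho4 p) hx.
- move=> q qz; apply: (is_derive_eq (is_deriveM (is_derive_cx q e_x) (is_derive_w e_x qz))).
  by rewrite ?fctE ?coordE /GRing.scale /=; ring.
- by move=> q qz; apply: continuous_atM => //; exact: ct_w.
- by move=> q qz; apply: continuous_atD; [apply: continuous_atM => //; exact: ct_dw|exact: ct_w].
have [|||a2 i2] := @half_sq_ibp e_y (fun p => cy p * (r2 p / rho4 p))
   (fun p => cy p * dw p e_y + r2 p / rho4 p) hy.
- move=> q qz; apply: (is_derive_eq (is_deriveM (is_derive_cy q e_y) (is_derive_w e_y qz))).
  by rewrite ?fctE ?coordE /GRing.scale /=; ring.
- by move=> q qz; apply: continuous_atM => //; exact: ct_w.
- by move=> q qz; apply: continuous_atD; [apply: continuous_atM => //; exact: ct_dw|exact: ct_w].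
have [|||a3 i3] := @half_sq_ibp e_z (fun p => 2 * cz p * (r2 p / rho4 p))
   (fun p => 2 * cz p * dw p e_z + 2 * (r2 p / rho4 p)) hz.
- move=> q qz; apply: (is_derive_eq (is_deriveM (is_deriveM (is_derive_cst (2 : R) q e_z) (is_derive_cz q e_z)) (is_derive_w e_z qz))).
  by rewrite ?fctE ?coordE /GRing.scale /=; ring.
- move=> q qz; apply: continuous_atM; last exact: ct_w.
  by continuity.
- move=> q qz; apply: continuous_atD; apply: continuous_atM.
  + by continuity.
  + exact: ct_dw.
  + exact: continuous_at_cst.
  + exact: ct_w.
apply: (null_eq Saxis adm (nullD cS clS Saxis (nullD cS clS Saxis (conj a1 i1) (conj a2 i2)) (conj a3 i3))).
move=> q qz; rewrite /dilation_null /dw /half_sq -/(fx q) -/(fy q) -/(fz q) -/(gx q) -/(gy q) -/(gz q).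
rewrite !coordE.
have N0 : rho4 q != 0 by rewrite lt0r_neq0// rho4_gt0.
have NE : rho4 q = r2 q ^+ 2 + 16 * cz q ^+ 2 by [].
have sE : r2 q = cx q ^+ 2 + cy q ^+ 2 by [].
move: (rho4 q) NE N0 => N NE N0; move: (r2 q) sE NE => s sE NE.
rewrite NE sE in N0 *; field; exact: N0.
Qed.

(** The hypotheses say that the gradient of [kappa] in [(x, y)] is radial, so [kappa] is constant
    along [x d_y - y d_x]. That field has no divergence, hence no term in [|u|^2] appears. *)
Lemma rotation_nullP (kappa m : heis R -> R) :
  (forall q, ~ zaxis q -> is_derive q e_x kappa (m q * cx q)) ->
  (forall q, ~ zaxis q -> is_derive q e_y kappa (m q * cy q)) ->
  (forall q, ~ zaxis q -> continuous_at q kappa) -> (forall q, ~ zaxis q -> continuous_at q m) ->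
  let I q := kappa q * (f q * (cx q * fy q - cy q * fx q) + g q * (cx q * gy q - cy q * gx q)) in
  null S I.
Proof.
move=> Dx Dy ck cm I.
have adm : admissible S I.
  split=> [q qz|q Sq]; last by rewrite /I f0// g0//; ring.
  have ckq := ck q qz; rewrite /I; continuity.
have [|||a1 i1] := @half_sq_ibp e_x (fun p => - cy p * kappa p) (fun p => - cy p * (m p * cx p)) hx.
- move=> q qz; apply: (is_derive_eq (is_deriveM (is_deriveN (is_derive_cy q e_x)) (Dx q qz))).
  by rewrite ?fctE ?coordE /GRing.scale /=; ring.
- by move=> q qz; have ckq := ck q qz; continuity.
- by move=> q qz; have cmq := cm q qz; continuity.
have [|||a2 i2] := @half_sq_ibp e_y (fun p => cx p * kappa p) (fun p => cx p * (m p * cy p)) hy.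
- move=> q qz; apply: (is_derive_eq (is_deriveM (is_derive_cx q e_y) (Dy q qz))).
  by rewrite ?fctE ?coordE /GRing.scale /=; ring.
- by move=> q qz; have ckq := ck q qz; continuity.
- by move=> q qz; have cmq := cm q qz; continuity.
apply: (null_eq Saxis adm (nullD cS clS Saxis (conj a1 i1) (conj a2 i2))).
by move=> q qz; rewrite /I -/(fx q) -/(fy q) -/(gx q) -/(gy q); ring.
Qed.

Lemma rotation_null_rho4 :
  let I q := 4 * cz q / rho4 q * (f q * (cx q * fy q - cy q * fx q) + g q * (cx q * gy q - cy q * gx q)) in
  null S I.
Proof.
have D q v : ~ zaxis q -> is_derive q v (fun p => 4 * cz p / rho4 p)
   ((4 * cz v * rho4 q - 4 * cz q * (4 * r2 q * (cx q * cx v + cy q * cy v) + 32 * cz q * cz v)) / rho4 q ^+ 2).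
  move=> qz; apply: is_derive_div; first by rewrite lt0r_neq0// rho4_gt0.
    apply: (is_derive_eq (is_deriveM (is_derive_cst (4 : R) q v) (is_derive_cz q v))).
    by rewrite ?fctE ?coordE /GRing.scale /=; ring.
  exact: is_derive_rho4.
apply: (@rotation_nullP _ (fun q => - (16 * cz q * r2 q) / rho4 q ^+ 2)).
- move=> q qz; apply: (is_derive_eq (D q e_x qz)).
  by rewrite !coordE [RHS]mulrAC; congr (_ / _); ring.
- move=> q qz; apply: (is_derive_eq (D q e_y qz)).
  by rewrite !coordE [RHS]mulrAC; congr (_ / _); ring.
- by move=> q qz; continuity; rewrite lt0r_neq0// rho4_gt0.
- by move=> q qz; continuity; rewrite expf_neq0// lt0r_neq0// rho4_gt0.
Qed.

Lemma rotation_null_r2 :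
  let I q := (r2 q)^-1 * (f q * (cx q * fy q - cy q * fx q) + g q * (cx q * gy q - cy q * gx q)) in
  null S I.
Proof.
have D q v : ~ zaxis q -> is_derive q v (fun p => (r2 p)^-1)
    ((0 * r2 q - 1 * (2 * (cx q * cx v + cy q * cy v))) / r2 q ^+ 2).
  move=> qz; have H := @is_derive_div R (fun=> 1) (@r2 R) q v 0 _ (lt0r_neq0 (r2_gt0 qz)) (is_derive_cst (1 : R) q v) (is_derive_r2 q v).
  suff <- : (fun p : heis R => 1 / r2 p) = (fun p => (r2 p)^-1) by [].
  by apply/funext => p; rewrite mul1r.
apply: (@rotation_nullP _ (fun q => - 2 / r2 q ^+ 2)).
- move=> q qz; apply: (is_derive_eq (D q e_x qz)).
  by rewrite !coordE [RHS]mulrAC; congr (_ / _); ring.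
- move=> q qz; apply: (is_derive_eq (D q e_y qz)).
  by rewrite !coordE [RHS]mulrAC; congr (_ / _); ring.
- by move=> q qz; continuity; rewrite lt0r_neq0// r2_gt0.
- by move=> q qz; continuity; rewrite expf_neq0// lt0r_neq0// r2_gt0.
Qed.

Lemma vertical_null : let I q := f q * fz q + g q * gz q in
  null S I.
Proof.
move=> I; have n1 := @half_sq_ibp e_z (fun=> 1) (fun=> 0) hz (fun q _ => is_derive_cst (1 : R) q e_z)
  (fun q _ => @continuous_at_cst _ _ (1 : R) q) (fun q _ => @continuous_at_cst _ _ (0 : R) q).
suff -> : I = (fun q => 0 * half_sq q + 1 * (f q * 'D_e_z f q + g q * 'D_e_z g q)) by [].
by apply/funext => q; rewrite mul0r add0r mul1r.
Qed.

Lemma product_ibp e (c : heis R -> R) (dc : R) (f1 f2 : heis R -> R) : e \in [:: e_x; e_y; e_z] ->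
  smooth f1 -> smooth f2 -> (forall q, ~ S q -> f1 q = 0) ->
  (forall q, is_derive q e c dc) -> (forall q, continuous_at q c) ->
  let I q := dc * (f1 q * f2 q) + c q * ('D_e f1 q * f2 q + f1 q * 'D_e f2 q) in
  null S I.
Proof.
move=> he s1 s2 f10 Dc cc.
have c1 q : continuous_at q f1 by exact: smooth_continuous.
have c2 q : continuous_at q f2 by exact: smooth_continuous.
have c3 q : continuous_at q (fun q => 'D_e f1 q) by exact: (smooth_continuous (smooth_derive s1 he)).
have c4 q : continuous_at q (fun q => 'D_e f2 q) by exact: (smooth_continuous (smooth_derive s2 he)).
apply: (hintegral_ibp cS clS Saxis he (dpsi := fun=> dc)).
- by move=> q _; exact: cc.
- by move=> q _; exact: continuous_at_cst.
- move=> q; have D1 := smooth_is_derive q s1 he; have D2 := smooth_is_derive q s2 he.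
  apply: (is_derive_eq (is_deriveM D1 D2)).
  by rewrite ?fctE ?coordE /GRing.scale /=; ring.
- by move=> q; apply: continuous_atM.
- by move=> q; apply: continuous_atD; apply: continuous_atM.
- by move=> q Sq; rewrite f10// mul0r.
Qed.

(* The Jacobian determinant [f_x g_z - f_z g_x] is a null Lagrangian. *)
Lemma jacobian_null :
  let I q := gz q * (cx q * fx q + cy q * fy q) - fz q * (cx q * gx q + cy q * gy q)
     + (gz q * f q - fz q * g q) in
  null S I.
Proof.
move=> I.
have fz0 q : ~ S q -> fz q = 0 by exact: (derive_notin clS).
have gz0 q : ~ S q -> gz q = 0 by exact: (derive_notin clS).
have adm : admissible S I.
  split=> [q qz|q Sq]; first by rewrite /I; continuity.
  by rewrite /I f0// g0// fz0// gz0//; ring.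
have sfx := smooth_derive sf hx; have sfy := smooth_derive sf hy; have sfz := smooth_derive sf hz.
have Dxx q : is_derive q e_x (@cx R) 1 by exact: is_derive_cx.
have Dxz q : is_derive q e_z (@cx R) 0 by exact: is_derive_cx.
have Dyy q : is_derive q e_y (@cy R) 1 by exact: is_derive_cy.
have Dyz q : is_derive q e_z (@cy R) 0 by exact: is_derive_cy.
(* [n1 - n2] is [x (f_x g_z - f_z g_x) - g f_z], since the mixed derivatives cancel, and [n3 - n4]
   is its analogue in [y]; [n5] turns the resulting [- 2 g f_z] into [f g_z - g f_z]. *)
have n1 := product_ibp hz sg sfx g0 Dxz ctx.
have n2 := product_ibp hx sg sfz g0 Dxx ctx.
have n3 := product_ibp hz sg sfy g0 Dyz cty.
have n4 := product_ibp hy sg sfz g0 Dyy cty.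
have n5 := product_ibp hz sf sg f0 (fun q => is_derive_cst (1 : R) q e_z) (fun q => @continuous_at_cst _ _ 1 q).
apply: (null_eq Saxis adm (nullD cS clS Saxis (nullD cS clS Saxis
  (nullD cS clS Saxis n1 (nullZ cS clS Saxis (-1) n2))
  (nullD cS clS Saxis n3 (nullZ cS clS Saxis (-1) n4))) n5)).
have identity (x y F G Fx Fy Fz Gx Gy Gz Fxz Fyz Fzx Fzy : R) : Fxz = Fzx -> Fyz = Fzy ->
  Gz * (x * Fx + y * Fy) - Fz * (x * Gx + y * Gy) + (Gz * F - Fz * G) =
  0 * (G * Fx) + x * (Gz * Fx + G * Fxz) + -1 * (1 * (G * Fz) + x * (Gx * Fz + G * Fzx)) +
  (0 * (G * Fy) + y * (Gz * Fy + G * Fyz) + -1 * (1 * (G * Fz) + y * (Gy * Fz + G * Fzy))) +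
  (0 * (F * G) + 1 * (Fz * G + F * Gz)) by move=> -> ->; ring.
by move=> q qz; exact: (identity _ _ _ _ _ _ _ _ _ _ _ _ _ _ (schwarz q sf hx hz) (schwarz q sf hy hz)).
Qed.

End null_integrals.

(** * Parity of derivatives, and the fields [r d_r] and [d_phi] *)

Lemma is_derive_unique (R : realType) (F : R -> R) (t d d' : R) :
  is_derive t 1 F d -> is_derive t 1 F d' -> d = d'.
Proof. by move=> [_ <-] [_ <-]. Qed.

Lemma derive_reflz (R : realType) (h : heis R -> R) : smooth h -> (forall p, h (reflz p) = h p) ->
  forall x y z : R, [/\ 'D_e_x h (x, y, - z) = 'D_e_x h (x, y, z),
    'D_e_y h (x, y, - z) = 'D_e_y h (x, y, z) & 'D_e_z h (x, y, - z) = - 'D_e_z h (x, y, z)].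
Proof.
move=> sh he x y z.
have Did (t : R) : is_derive t (1 : R) (fun s : R => s) 1 by exact: is_derive_id.
have Dcst (c t : R) : is_derive t (1 : R) (fun _ : R => c) 0 by exact: is_derive_cst.
have DN : is_derive z (1 : R) (fun s : R => - s) (- 1) by apply: is_deriveN.
split.
- have H1 := is_derive_curve sh (Did x) (Dcst y x) (Dcst (- z) x).
  have H2 := is_derive_curve sh (Did x) (Dcst y x) (Dcst z x).
  have E : (fun s => h (s, y, - z)) = (fun s => h (s, y, z)) by apply/funext => s; exact: (he (s, y, z)).
  rewrite E in H1.
  have alg (A B C A' B' C' : R) : A * 1 + B * 0 + C * 0 = A' * 1 + B' * 0 + C' * 0 -> A = A'.
    by rewrite !mulr0 !mulr1 !addr0.
  exact: (alg _ _ _ _ _ _ (is_derive_unique H1 H2)).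
- have H1 := is_derive_curve sh (Dcst x y) (Did y) (Dcst (- z) y).
  have H2 := is_derive_curve sh (Dcst x y) (Did y) (Dcst z y).
  have E : (fun s => h (x, s, - z)) = (fun s => h (x, s, z)) by apply/funext => s; exact: (he (x, s, z)).
  rewrite E in H1.
  have alg (A B C A' B' C' : R) : A * 0 + B * 1 + C * 0 = A' * 0 + B' * 1 + C' * 0 -> B = B'.
    by rewrite !mulr0 !mulr1 !addr0 !add0r.
  exact: (alg _ _ _ _ _ _ (is_derive_unique H1 H2)).
- have H1 := is_derive_curve sh (Dcst x z) (Dcst y z) DN.
  have H2 := is_derive_curve sh (Dcst x z) (Dcst y z) (Did z).
  have E : (fun s => h (x, y, - s)) = (fun s => h (x, y, s)) by apply/funext => s; exact: (he (x, y, s)).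
  rewrite E in H1.
  have alg (A B C A' B' C' : R) : A * 0 + B * 0 + C * -1 = A' * 0 + B' * 0 + C' * 1 -> C = - C'.
    by rewrite !mulr0 mulrN !mulr1 !addr0 !add0r => <-; rewrite opprK.
  exact: (alg _ _ _ _ _ _ (is_derive_unique H1 H2)).
Qed.

Section polar_fields.
Variable R : realType.
Implicit Types (q : heis R) (h : heis R -> R).

(** [euler] is [r d_r] and [angular] is [d_phi], written in the partial derivatives: both are free
    of divisions and continuous on the axis when these are. *)
Definition euler (hx hy : heis R -> R) q : R := cx q * hx q + cy q * hy q.
Definition angular (hx hy : heis R -> R) q : R := cx q * hy q - cy q * hx q.

Lemma continuous_euler (hx hy : heis R -> R) q : continuous_at q hx -> continuous_at q hy ->
  continuous_at q (euler hx hy).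
Proof.
move=> c1 c2; have ctx : continuous_at q (@cx R) by exact: continuous_cx.
by have cty : continuous_at q (@cy R) by [exact: continuous_cy|]; rewrite /euler; continuity.
Qed.

Lemma continuous_angular (hx hy : heis R -> R) q : continuous_at q hx -> continuous_at q hy ->
  continuous_at q (angular hx hy).
Proof.
move=> c1 c2; have ctx : continuous_at q (@cx R) by exact: continuous_cx.
by have cty : continuous_at q (@cy R) by [exact: continuous_cy|]; rewrite /angular; continuity.
Qed.

End polar_fields.

Lemma is_derive_rot (R : realType) (h : heis R -> R) (q : heis R) (t : R) : smooth h ->
  is_derive t (1 : R) (fun s => h (Defs.rot s q))
    (angular (fun q => 'D_e_x h q) (fun q => 'D_e_y h q) (Defs.rot t q)).
Proof.
move=> sh.
have D1 : is_derive t (1 : R) (fun s => cx q * cos s - cy q * sin s) (- (cx q * sin t + cy q * cos t)).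
  apply: (is_derive_eq (is_deriveB (is_deriveM (is_derive_cst (cx q) t 1) (is_derive_cos t))
    (is_deriveM (is_derive_cst (cy q) t 1) (is_derive_sin t)))).
  by rewrite /GRing.scale /=; ring.
have D2 : is_derive t (1 : R) (fun s => cx q * sin s + cy q * cos s) (cx q * cos t - cy q * sin t).
  apply: (is_derive_eq (is_deriveD (is_deriveM (is_derive_cst (cx q) t 1) (is_derive_sin t))
    (is_deriveM (is_derive_cst (cy q) t 1) (is_derive_cos t)))).
  by rewrite /GRing.scale /=; ring.
apply: (is_derive_eq (is_derive_curve sh D1 D2 (is_derive_cst (cz q) t 1))).
have alg (A B C X Y : R) : A * - X + B * Y + C * 0 = Y * B - X * A by ring.
exact: alg.
Qed.

(** * Integrated inequalities for the real and imaginary parts *)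

Section energy.
Variables (R : realType) (S : set (heis R)) (f g : heis R -> R).
Hypotheses (cS : compact S) (clS : closed S) (Saxis : S `<=` ~` zaxis).
Hypotheses (sf : smooth f) (sg : smooth g).
Hypotheses (f0 : forall q, ~ S q -> f q = 0) (g0 : forall q, ~ S q -> g q = 0).
Implicit Types (q v e : heis R) (h k : heis R -> R).

(* Opaque names for the partial derivatives keep [ring] and [lra] from unfolding the limits. *)
Variables (fx fy fz gx gy gz : heis R -> R).
Hypotheses (Efx : fx = (fun q => 'D_e_x f q)) (Efy : fy = (fun q => 'D_e_y f q)).
Hypotheses (Efz : fz = (fun q => 'D_e_z f q)) (Egx : gx = (fun q => 'D_e_x g q)).
Hypotheses (Egy : gy = (fun q => 'D_e_y g q)) (Egz : gz = (fun q => 'D_e_z g q)).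

Definition sqmod q : R := f q ^+ 2 + g q ^+ 2.

(** The integrand of [Qform], with [r R u] and [r Phi u = d_phi u + r^2 / 2 d_z u] squared over
    [r^2], so that no square root occurs. *)
Definition energy_density alpha q : R :=
  (euler fx fy q ^+ 2 + euler gx gy q ^+ 2 +
   (angular fx fy q + r2 q / 2 * fz q - alpha * g q) ^+ 2 +
   (angular gx gy q + r2 q / 2 * gz q + alpha * f q) ^+ 2) / r2 q.

(** The real part of [- i Phi u] times the conjugate of [u / r]. *)
Definition current_density q : R :=
  ((angular gx gy q + r2 q / 2 * gz q) * f q -
   (angular fx fy q + r2 q / 2 * fz q) * g q) / r2 q.

Definition angular_density alpha q : R :=
  ((angular fx fy q - alpha * g q) ^+ 2 + (angular gx gy q + alpha * f q) ^+ 2) / r2 q.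

Definition cross_density alpha q : R :=
  (angular fx fy q - alpha * g q) * fz q + (angular gx gy q + alpha * f q) * gz q.

Let hx : e_x \in [:: @e_x R; e_y; e_z]. Proof. by rewrite !inE eqxx. Qed.
Let hy : e_y \in [:: @e_x R; e_y; e_z]. Proof. by rewrite !inE eqxx orbT. Qed.
Let hz : e_z \in [:: @e_x R; e_y; e_z]. Proof. by rewrite !inE eqxx !orbT. Qed.

Let ctf q : continuous_at q f. Proof. exact: smooth_continuous. Qed.
Let ctg q : continuous_at q g. Proof. exact: smooth_continuous. Qed.

Let ctx q : continuous_at q (@cx R). Proof. exact: continuous_cx. Qed.
Let cty q : continuous_at q (@cy R). Proof. exact: continuous_cy. Qed.
Let ctz q : continuous_at q (@cz R). Proof. exact: continuous_cz. Qed.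
Let ctr2 q : continuous_at q (@r2 R). Proof. exact: continuous_at_r2. Qed.
Let ctrho4 q : continuous_at q (@rho4 R). Proof. exact: continuous_at_rho4. Qed.

Let ctfx q : continuous_at q fx.
Proof. by rewrite Efx; exact: (smooth_continuous (smooth_derive sf hx)). Qed.
Let ctfy q : continuous_at q fy.
Proof. by rewrite Efy; exact: (smooth_continuous (smooth_derive sf hy)). Qed.
Let ctfz q : continuous_at q fz.
Proof. by rewrite Efz; exact: (smooth_continuous (smooth_derive sf hz)). Qed.
Let ctgx q : continuous_at q gx.
Proof. by rewrite Egx; exact: (smooth_continuous (smooth_derive sg hx)). Qed.
Let ctgy q : continuous_at q gy.
Proof. by rewrite Egy; exact: (smooth_continuous (smooth_derive sg hy)). Qed.
Let ctgz q : continuous_at q gz.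
Proof. by rewrite Egz; exact: (smooth_continuous (smooth_derive sg hz)). Qed.

Let cte q : continuous_at q (euler fx fy). Proof. exact: continuous_euler. Qed.
Let cte' q : continuous_at q (euler gx gy). Proof. exact: continuous_euler. Qed.
Let cta q : continuous_at q (angular fx fy). Proof. exact: continuous_angular. Qed.
Let cta' q : continuous_at q (angular gx gy). Proof. exact: continuous_angular. Qed.

Let zeroE q : ~ S q -> [/\ f q = 0, g q = 0, euler fx fy q = 0, euler gx gy q = 0 & angular fx fy q = 0] /\
  [/\ angular gx gy q = 0, fz q = 0 & gz q = 0].
Proof.
move=> Sq; have z0 h e : (forall p, ~ S p -> h p = 0) -> 'D_e h q = 0.
  by move=> h0; exact: (derive_notin clS).
have [fx0 fy0 fz0] : [/\ fx q = 0, fy q = 0 & fz q = 0] by rewrite Efx Efy Efz; split; exact: z0.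
have [gx0 gy0 gz0] : [/\ gx q = 0, gy q = 0 & gz q = 0] by rewrite Egx Egy Egz; split; exact: z0.
by rewrite /euler /angular f0// g0// fx0 fy0 fz0 gx0 gy0 gz0 !mulr0 addr0 subr0.
Qed.

Lemma energy_admissible alpha : admissible S (energy_density alpha).
Proof.
split=> [q qz|q Sq].
  by rewrite /energy_density; continuity; rewrite lt0r_neq0// r2_gt0.
by have [[h1 h2 h3 h4 h5] [h6 h7 h8]] := zeroE Sq; rewrite /energy_density h1 h2 h3 h4 h5 h6 h7 h8; ring.
Qed.

Lemma hardy_admissible : admissible S (fun q => r2 q / rho4 q * sqmod q).
Proof.
split=> [q qz|q Sq]; first by rewrite /sqmod; continuity; rewrite lt0r_neq0// rho4_gt0.
by have [[h1 h2 _ _ _] _] := zeroE Sq; rewrite /sqmod h1 h2; ring.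
Qed.

Lemma inv_square_admissible : admissible S (fun q => sqmod q / r2 q).
Proof.
split=> [q qz|q Sq]; first by rewrite /sqmod; continuity; rewrite lt0r_neq0// r2_gt0.
by have [[h1 h2 _ _ _] _] := zeroE Sq; rewrite /sqmod h1 h2; ring.
Qed.

Lemma inv_square_grad_admissible : admissible S (fun q => sqmod q / r2 q * (1 - r2 q ^+ 2 / rho4 q)).
Proof.
split=> [q qz|q Sq].
  by rewrite /sqmod; continuity; rewrite lt0r_neq0// ?r2_gt0// rho4_gt0.
by have [[h1 h2 _ _ _] _] := zeroE Sq; rewrite /sqmod h1 h2; ring.
Qed.

Lemma current_admissible : admissible S current_density.
Proof.
split=> [q qz|q Sq].
  by rewrite /current_density; continuity; rewrite lt0r_neq0// r2_gt0.
by have [[h1 h2 _ _ _] _] := zeroE Sq; rewrite /current_density h1 h2; ring.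
Qed.

Lemma angular_admissible alpha : admissible S (angular_density alpha).
Proof.
split=> [q qz|q Sq].
  by rewrite /angular_density; continuity; rewrite lt0r_neq0// r2_gt0.
by have [[h1 h2 _ _ h5] [h6 _ _]] := zeroE Sq; rewrite /angular_density h1 h2 h5 h6; ring.
Qed.

Lemma cross_admissible alpha : admissible S (cross_density alpha).
Proof.
split=> [q qz|q Sq]; first by rewrite /cross_density; continuity.
by have [_ [_ h7 h8]] := zeroE Sq; rewrite /cross_density h7 h8; ring.
Qed.

(** One three-term form serves all the estimates; shorter combinations are padded with a coefficient
    0. *)
Lemma hintegral_lincomb h1 h2 h3 (c2 c3 : R) : admissible S h1 -> admissible S h2 -> admissible S h3 ->
  admissible S (fun q => h1 q + (c2 * h2 q + c3 * h3 q)) /\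
  hintegral (fun q => h1 q + (c2 * h2 q + c3 * h3 q)) =
  hintegral h1 + (c2 * hintegral h2 + c3 * hintegral h3).
Proof.
move=> a1 a2 a3; have b2 := admissibleZ c2 a2; have b3 := admissibleZ c3 a3.
have b := admissibleD b2 b3; split; first exact: admissibleD.
rewrite (hintegralD cS clS Saxis a1 b) (hintegralD cS clS Saxis b2 b3).
by rewrite (hintegralZ cS clS Saxis c2 a2) (hintegralZ cS clS Saxis c3 a3).
Qed.

Let dilation q := r2 q / rho4 q * (f q * (euler fx fy q + 2 * cz q * fz q) +
  g q * (euler gx gy q + 2 * cz q * gz q) + (f q ^+ 2 + g q ^+ 2)).

Let dil_null : null S dilation.
Proof.
by rewrite /dilation /euler Efx Efy Efz Egx Egy Egz; exact: (dilation_nullP cS clS Saxis sf sg f0 g0).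
Qed.

Let rot_null : null S (fun q => 4 * cz q / rho4 q * (f q * angular fx fy q + g q * angular gx gy q)).
Proof.
by rewrite /angular Efx Efy Egx Egy; exact: (rotation_null_rho4 cS clS Saxis sf sg f0 g0).
Qed.

Let rot2_null : null S (fun q => (r2 q)^-1 * (f q * angular fx fy q + g q * angular gx gy q)).
Proof.
by rewrite /angular Efx Efy Egx Egy; exact: (rotation_null_r2 cS clS Saxis sf sg f0 g0).
Qed.

Let ver_null : null S (fun q => f q * fz q + g q * gz q).
Proof. by rewrite Efz Egz; exact: (vertical_null cS clS Saxis sf sg f0 g0). Qed.

Let jac_null : null S (fun q => gz q * euler fx fy q - fz q * euler gx gy q + (gz q * f q - fz q * g q)).
Proof.
by rewrite /euler Efx Efy Efz Egx Egy Egz; exact: (jacobian_null cS clS Saxis sf sg f0 g0).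
Qed.

(** With [I] the inverse-square integral and [J] the current, the sum of squares bounds the
    difference below by [gamma^2 I + 2 gamma (J + n I)]; the hypothesis of (i) is that the second
    term is nonnegative. *)
Lemma hardy_magnetic (alpha gamma n : R) : alpha = n + gamma ->
  0 <= gamma * (hintegral current_density + n * hintegral (fun q => sqmod q / r2 q)) ->
  gamma ^+ 2 * hintegral (fun q => sqmod q / r2 q) <=
  hintegral (energy_density alpha) - hintegral (fun q => r2 q / rho4 q * sqmod q).
Proof.
move=> aE cond.
have [a1 i1] := hintegral_lincomb (-1) (- (gamma ^+ 2 + 2 * gamma * n)) (energy_admissible alpha) hardy_admissible inv_square_admissible.
have [a2 i2] := hintegral_lincomb (- (2 * gamma)) 0 a1 current_admissible current_admissible.
have nn := nullD cS clS Saxis (nullZ cS clS Saxis 2 dil_null) (nullZ cS clS Saxis 2 rot_null).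
have : 0 <= hintegral (fun q => energy_density alpha q + (-1 * (r2 q / rho4 q * sqmod q) + - (gamma ^+ 2 + 2 * gamma * n) * (sqmod q / r2 q)) +
   (- (2 * gamma) * current_density q + 0 * current_density q)).
  apply: (le_hintegral_null cS clS Saxis a2 nn) => q qz.
  have H := @hardy_square R (r2 q) (cz q) (euler fx fy q) (euler gx gy q) (angular fx fy q) (angular gx gy q) (fz q) (gz q) (f q) (g q)
    alpha gamma n (rho4 q) (r2_gt0 qz) aE (erefl (rho4 q)).
  apply: (le_trans H); rewrite le_eqVlt; apply/orP; left; apply/eqP.
  rewrite /energy_density /current_density /dilation /sqmod.
  by ring.
rewrite i2 i1; lra.
Qed.

Lemma hardy_eigen (alpha gamma n : R) : gamma ^+ 2 <= 1 / 4 -> gamma ^+ 2 <= (alpha + n) ^+ 2 ->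
  (forall q, ~ zaxis q -> angular fx fy q = - (n * g q) /\ angular gx gy q = n * f q) ->
  gamma ^+ 2 * hintegral (fun q => sqmod q / r2 q * (1 - r2 q ^+ 2 / rho4 q)) <=
  hintegral (energy_density alpha) - hintegral (fun q => r2 q / rho4 q * sqmod q).
Proof.
move=> g4 gb eig; set beta := alpha + n; pose k := - beta / (1 + beta ^+ 2 - gamma ^+ 2).
have [a1 i1] := hintegral_lincomb (-1) (- gamma ^+ 2) (energy_admissible alpha) hardy_admissible inv_square_grad_admissible.
have nn := nullD cS clS Saxis (nullZ cS clS Saxis k jac_null) (nullZ cS clS Saxis (2 + 2 * k * beta) dil_null).
have : 0 <= hintegral (fun q => energy_density alpha q + (-1 * (r2 q / rho4 q * sqmod q) +
    - gamma ^+ 2 * (sqmod q / r2 q * (1 - r2 q ^+ 2 / rho4 q)))).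
  apply: (le_hintegral_null cS clS Saxis a1 nn) => q qz.
  have H := @hardy_square_eigen R (r2 q) (cz q) (euler fx fy q) (euler gx gy q) (fz q) (gz q) (f q) (g q)
    n alpha beta gamma k (rho4 q) (r2_gt0 qz) g4 gb (erefl beta) (erefl k) (erefl (rho4 q)).
  apply: (le_trans H); rewrite le_eqVlt; apply/orP; left; apply/eqP.
  have [E1 E2] := eig q qz.
  rewrite /energy_density /dilation E1 E2 /sqmod.
  by ring.
rewrite i1; lra.
Qed.

Lemma hardy_even (alpha : R) :
  (forall q, f (reflz q) = f q) -> (forall q, g (reflz q) = g q) ->
  hintegral (angular_density alpha) <=
  hintegral (energy_density alpha) - hintegral (fun q => r2 q / rho4 q * sqmod q).
Proof.
move=> fe ge.
have Df q : [/\ fx (reflz q) = fx q, fy (reflz q) = fy q & fz (reflz q) = - fz q].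
  by rewrite Efx Efy Efz; case: q => [[x y] z]; exact: derive_reflz.
have Dg q : [/\ gx (reflz q) = gx q, gy (reflz q) = gy q & gz (reflz q) = - gz q].
  by rewrite Egx Egy Egz; case: q => [[x y] z]; exact: derive_reflz.
have odd q : cross_density alpha (reflz q) = -1 * cross_density alpha q.
  rewrite /cross_density /angular fe ge.
  have [-> -> ->] := Df q; have [-> -> ->] := Dg q.
  by have [-> ->] : cx (reflz q) = cx q /\ cy (reflz q) = cy q; [|ring].
have X0 : null S (cross_density alpha).
  split; first exact: cross_admissible.
  have ac := cross_admissible alpha; have ac' := admissibleZ (-1) ac.
  have E : cross_density alpha \o @reflz R = (fun q => -1 * cross_density alpha q).
    by apply/funext => q; exact: odd.
  have cc : ccont (cross_density alpha \o @reflz R).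
    by rewrite E; exact: (admissible_ccont cS clS Saxis ac').
  have := hintegral_reflz (admissible_ccont cS clS Saxis ac) cc.
  rewrite E (hintegralZ cS clS Saxis (-1) ac); lra.
have [a1 i1] := hintegral_lincomb (-1) (-1) (energy_admissible alpha) hardy_admissible (angular_admissible alpha).
have nn := nullD cS clS Saxis (nullZ cS clS Saxis (-1) X0) (nullZ cS clS Saxis 2 dil_null).
have : 0 <= hintegral (fun q => energy_density alpha q + (-1 * (r2 q / rho4 q * sqmod q) + -1 * angular_density alpha q)).
  apply: (le_hintegral_null cS clS Saxis a1 nn) => q qz.
  have H := @hardy_square_even R (r2 q) (cz q) (euler fx fy q) (euler gx gy q) (angular fx fy q) (angular gx gy q) (fz q) (gz q) (f q) (g q)
    alpha (rho4 q) (r2_gt0 qz) (erefl (rho4 q)).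
  apply: (le_trans H); rewrite le_eqVlt; apply/orP; left; apply/eqP.
  rewrite /energy_density /angular_density /cross_density /dilation /sqmod.
  by ring.
rewrite i1; lra.
Qed.

Lemma angular_wirtinger (alpha gamma : R) (n : int) : alpha = n%:~R + gamma -> `|gamma| <= 1 / 2 ->
  gamma ^+ 2 * hintegral (fun q => sqmod q / r2 q) <= hintegral (angular_density alpha).
Proof.
move=> aE g2.
have [a1 i1] := hintegral_lincomb (- gamma ^+ 2) 0 (angular_admissible alpha) inv_square_admissible inv_square_admissible.
have : 0 <= hintegral (fun q => angular_density alpha q + (- gamma ^+ 2 * (sqmod q / r2 q) + 0 * (sqmod q / r2 q))).
  apply: hintegral_rot_average_ge0 => [|q]; first exact: (admissible_ccont cS clS Saxis a1).
  (* [r] is constant on the circle through [q], so [u / r] satisfies the same one-variable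
     inequality as [u]. On the axis [c = 0], in agreement with the value 0 of [1 / r^2] there. *)
  pose c : R := (Num.sqrt (r2 q))^-1.
  have c2 : c ^+ 2 = (r2 q)^-1 by rewrite exprVn sqr_sqrtr// addr_ge0 ?sqr_ge0.
  have r2rot t : r2 (Defs.rot t q) = r2 q.
    rewrite /r2 /Defs.rot /cx /cy /=; set x := q.1.1; set y := q.1.2.
    transitivity ((x ^+ 2 + y ^+ 2) * (cos t ^+ 2 + sin t ^+ 2)); first by ring.
    by rewrite cos2Dsin2 mulr1.
  have Dc (h d : R -> R) (t : R) : is_derive t (1 : R) h (d t) -> is_derive t (1 : R) (fun s => h s * c) (d t * c).
    move=> sh; apply: (is_derive_eq (is_deriveM sh (is_derive_cst c t 1))).
    by rewrite /GRing.scale /=; ring.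
  have Df t : is_derive t (1 : R) (fun s => f (Defs.rot s q)) (angular fx fy (Defs.rot t q)).
    by rewrite Efx Efy; exact: is_derive_rot.
  have Dg t : is_derive t (1 : R) (fun s => g (Defs.rot s q)) (angular gx gy (Defs.rot t q)).
    by rewrite Egx Egy; exact: is_derive_rot.
  have crot : continuous (fun t => Defs.rot t q).
    move=> t; have cc : continuous_at t cos by exact: continuous_cos.
    have cs : continuous_at t sin by exact: continuous_sin.
    apply: (@for_continuous_triple _ _ (fun t => cx q * cos t - cy q * sin t)
      (fun t => cx q * sin t + cy q * cos t) (fun=> cz q)).
    - change (continuous_at t (fun t => cx q * cos t - cy q * sin t)); continuity.
    - change (continuous_at t (fun t => cx q * sin t + cy q * cos t)); continuity.
    - exact: continuous_at_cst.
  have cang (h : heis R -> R) : (forall p, continuous_at p h) -> continuous (fun t => h (Defs.rot t q) * c).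
    move=> ch t; apply: continuous_atM; last exact: continuous_at_cst.
    by apply: (@continuous_comp _ _ _ (fun t => Defs.rot t q) h); [exact: crot|exact: ch].
  have rot2pi : Defs.rot (pi *+ 2) q = Defs.rot 0 q.
    rewrite /Defs.rot cos2pi cos0 sin0.
    by have -> : sin (pi *+ 2 : R) = 0 by rewrite mulr2n sinD sinpi mul0r mulr0 addr0.
  have := @magnetic_wirtinger R alpha gamma n _ _ _ _ aE g2 (fun t => Dc _ (fun t => angular fx fy (Defs.rot t q)) t (Df t))
    (fun t => Dc _ (fun t => angular gx gy (Defs.rot t q)) t (Dg t))
    (cang _ cta) (cang _ cta').
  rewrite !rot2pi => /(_ erefl erefl); congr (_ <= _)%E; apply: eq_integral => t _; congr (_%:E).
  by rewrite /angular_density /sqmod r2rot -c2; ring.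
rewrite i1; lra.
Qed.

Lemma inv_square_grad_le : hintegral (fun q => sqmod q / r2 q * (1 - r2 q ^+ 2 / rho4 q)) <=
  hintegral (fun q => sqmod q / r2 q).
Proof.
have [a1 i1] := hintegral_lincomb (-1) 0 inv_square_admissible inv_square_grad_admissible inv_square_admissible.
have n0 := nullZ cS clS Saxis 0 dil_null.
have : 0 <= hintegral (fun q => sqmod q / r2 q + (-1 * (sqmod q / r2 q * (1 - r2 q ^+ 2 / rho4 q)) + 0 * (sqmod q / r2 q))).
  apply: (le_hintegral_null cS clS Saxis a1 n0) => q qz.
  have : 0 <= sqmod q / r2 q * (r2 q ^+ 2 / rho4 q).
    apply: mulr_ge0; apply: divr_ge0; rewrite ?sqr_ge0//.
    - by rewrite addr_ge0// sqr_ge0.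
    - by rewrite ltW// r2_gt0.
    - by rewrite ltW// rho4_gt0.
  move=> H; apply: (le_trans H); rewrite le_eqVlt; apply/orP; left; apply/eqP; ring.
rewrite i1; lra.
Qed.

(** The skew-symmetry of [Phi]: the integrand is the imaginary part of the inner product in the
    angular condition, and the order of [R[i]] requires it to integrate to 0. *)
Lemma skew_phi : hintegral (fun q => - (((angular fx fy q + r2 q / 2 * fz q) * f q +
   (angular gx gy q + r2 q / 2 * gz q) * g q) / r2 q)) = 0.
Proof.
have nn := nullD cS clS Saxis (nullZ cS clS Saxis (-1) rot2_null) (nullZ cS clS Saxis (- (1 / 2)) ver_null).
suff : null S (fun q => - (((angular fx fy q + r2 q / 2 * fz q) * f q +
   (angular gx gy q + r2 q / 2 * gz q) * g q) / r2 q)) by case.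
apply: (null_eq Saxis _ nn).
  split=> [q qz|q Sq]; first by continuity; rewrite lt0r_neq0// r2_gt0.
  by rewrite f0// g0// !mulr0 addr0 mul0r oppr0.
move=> q qz; have s0 := lt0r_neq0 (r2_gt0 qz).
by field.
Qed.

End energy.

(** * Splittings of [alpha] and the distance to the integers *)

Section distance_to_integers.
Variable R : realType.
Implicit Types (alpha gamma : R) (n m : int).

Let dist_lbound alpha : has_lbound [set `|alpha - m%:~R| | m in [set: int]].
Proof. by exists 0 => _ [m _ <-]; exact: normr_ge0. Qed.

Let dist_nonempty alpha : [set `|alpha - m%:~R| | m in [set: int]] !=set0.
Proof. by exists `|alpha - 0%:~R|, 0. Qed.

Lemma distZ_ge0 alpha : 0 <= distZ alpha.
Proof. by apply: lb_le_inf => // _ [m _ <-]; exact: normr_ge0. Qed.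

Lemma distZ_le alpha m : distZ alpha <= `|alpha - m%:~R|.
Proof. by apply: (ge_inf (dist_lbound alpha)); exists m. Qed.

Lemma distZ_le_half alpha : distZ alpha <= 1 / 2.
Proof.
apply: (le_trans (distZ_le alpha (Num.floor (alpha + 1 / 2)))).
have /andP[h1 h2] := floor_itv (alpha + 1 / 2); rewrite intrD in h2.
by rewrite ler_norml; apply/andP; split; lra.
Qed.

Lemma intr_cases m : [\/ m = 0, (1 : R) <= m%:~R | m%:~R <= (-1 : R)].
Proof.
have [m0|m0|->] := ltrgtP m 0; last exact: Or31.
- by apply: Or33; have : m <= - 1 by [rewrite -ltzD1 addNr]; rewrite -(ler_int R).
- by apply: Or32; have : 1 <= m by [rewrite -gtz0_ge1]; rewrite -(ler_int R).
Qed.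

Lemma distZ_small alpha : `|alpha| <= 1 / 2 -> distZ alpha = `|alpha|.
Proof.
move=> a2; apply/eqP; rewrite eq_le; apply/andP; split.
  by have := distZ_le alpha 0; rewrite subr0.
apply: lb_le_inf => // _ [m _ <-]; move: a2; rewrite ler_norml => /andP[h1 h2].
have [->|m1|m1] := intr_cases m; first by rewrite subr0.
- by rewrite [in leRHS]ler0_norm; [rewrite ler_norml; apply/andP; split|]; lra.
- by rewrite [in leRHS]ger0_norm; [rewrite ler_norml; apply/andP; split|]; lra.
Qed.

Lemma splits_norm alpha n gamma : splits alpha n gamma -> `|gamma| = distZ alpha.
Proof. have /ger0_norm d0 := distZ_ge0 alpha; case=> _ [E|E]; rewrite E.
  exact: d0.
by rewrite normrN. Qed.

Lemma splits_sqr alpha n gamma : splits alpha n gamma -> gamma ^+ 2 = distZ alpha ^+ 2.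
Proof. by move=> /splits_norm <-; rewrite real_normK// num_real. Qed.

Lemma splits_le_half alpha n gamma : splits alpha n gamma -> `|gamma| <= 1 / 2.
Proof. by move=> /splits_norm ->; exact: distZ_le_half. Qed.

(** The strict bound matters: [1 / 2 = 1 - 1 / 2] is a splitting with [n = 1] and [gamma n < 0]. *)
Lemma splits_small alpha n gamma : splits alpha n gamma -> `|alpha| < 1 / 2 -> n = 0.
Proof.
move=> sp a2; have ga := splits_norm sp; case: sp => aE _.
rewrite distZ_small ?ltW// in ga; have g2 : `|gamma| < 1 / 2 by rewrite ga.
move: a2 g2; rewrite !ltr_norml => /andP[h1 h2] /andP[h3 h4].
by have [//|m1|m1] := intr_cases n; exfalso; lra.
Qed.

Lemma splits0 alpha : `|alpha| <= 1 / 2 -> splits alpha 0 alpha.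
Proof.
move=> a2; split; first by rewrite add0r.
by rewrite distZ_small//; have [a0|a0] := leP 0 alpha; [left; rewrite ger0_norm|right; rewrite ltr0_norm// opprK].
Qed.

(* On the eigenspace [- i d_phi u = n u] the angular coefficient is [alpha + n = 2 n + gamma]. *)
Lemma splits_sqr_le alpha n gamma : splits alpha n gamma ->
  gamma ^+ 2 <= (alpha + n%:~R) ^+ 2.
Proof.
move=> sp; have := splits_le_half sp; case: sp => -> _; rewrite ler_norml => /andP[h1 h2].
rewrite -subr_ge0; have -> : (n%:~R + gamma + n%:~R) ^+ 2 - gamma ^+ 2 = 4 * n%:~R * (n%:~R + gamma) by ring.
have [->|m1|m1] := intr_cases n; first by rewrite mulr0 mul0r.
- by apply: mulr_ge0; lra.
- by apply: mulr_le0; lra.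
Qed.

End distance_to_integers.

(** * Polar derivatives and the gradient of [rho] *)

Section polar_derivatives.
Variable R : realType.
Implicit Types (q : heis R) (h : heis R -> R).

Lemma sqr_rr q : rr q ^+ 2 = r2 q.
Proof. by rewrite sqr_sqrtr// addr_ge0// sqr_ge0. Qed.

Lemma rr_eq0 q : (rr q == 0) = (r2 q == 0).
Proof. by rewrite -sqr_rr sqrf_eq0. Qed.

Lemma zaxis_r2 q : r2 q = 0 -> zaxis q.
Proof. by move=> q0; apply: contrapT => /r2_gt0; rewrite q0 ltxx. Qed.

Lemma derive1_radial h q : smooth h ->
  derive1 (fun s => h (s * (cx q / rr q), s * (cy q / rr q), cz q)) (rr q) =
  euler (fun q => 'D_e_x h q) (fun q => 'D_e_y h q) q / rr q.
Proof.
move=> sh; have lin (k : R) : is_derive (rr q) (1 : R) (fun s => s * k) k.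
  apply: (is_derive_eq (is_deriveM (is_derive_id (rr q) (1 : R)) (is_derive_cst k (rr q) 1))).
  by rewrite /GRing.scale /= mulr0 add0r mulr1.
(* On the axis the quotients are 0 and so are [x] and [y]; the formula thus holds at every point. *)
have P : (rr q * (cx q / rr q), rr q * (cy q / rr q), cz q) = q.
  have [r0|r0] := eqVneq (rr q) 0.
    have [x0 y0] : zaxis q by apply: zaxis_r2; apply/eqP; rewrite -rr_eq0 r0.
    by move: x0 y0; rewrite r0 !mul0r /cx /cy /cz; case: (q) => [[a b] c] /= -> ->.
  by rewrite ![rr q * (_ / _)]mulrC !mulfVK//; case: (q) => [[? ?] ?].
have [_ D] := is_derive_curve sh (lin (cx q / rr q)) (lin (cy q / rr q)) (is_derive_cst (cz q) (rr q) 1).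
rewrite derive1E D P.
have alg (A B X Y C r : R) : A * (X / r) + B * (Y / r) + C * 0 = (X * A + Y * B) / r by ring.
exact: alg.
Qed.

Lemma derive1_angular h q : smooth h ->
  derive1 (fun t => h (Defs.rot t q)) 0 = angular (fun q => 'D_e_x h q) (fun q => 'D_e_y h q) q.
Proof.
move=> sh; have [_ D] := is_derive_rot q 0 sh; rewrite derive1E D.
congr (angular _ _ _); rewrite /Defs.rot cos0 sin0 !mulr0 !mulr1 subr0 add0r.
by case: (q) => [[? ?] ?].
Qed.

Lemma derive1_vertical h q : smooth h ->
  derive1 (fun s => h (cx q, cy q, s)) (cz q) = 'D_e_z h q.
Proof.
move=> sh; have [_ D] := is_derive_curve sh (is_derive_cst (cx q) (cz q) 1)
  (is_derive_cst (cy q) (cz q) 1) (is_derive_id (cz q) (1 : R)).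
have P : (cx q, cy q, cz q) = q by case: (q) => [[? ?] ?].
rewrite derive1E D P.
have alg (A B C : R) : A * 0 + B * 0 + C * 1 = C by ring.
exact: alg.
Qed.

Lemma rho_rho4 q : rho q ^+ 4 = rho4 q.
Proof.
have r0 : 0 <= rho4 q by rewrite addr_ge0 ?sqr_ge0// mulr_ge0// sqr_ge0.
rewrite -powR_mulrn ?powR_ge0// /rho -powRrM mul1r mulVf ?powRr1//.
Qed.

Lemma hgrad_norm_rho q : ~ zaxis q -> hgrad_norm (@rho R) q ^+ 4 = r2 q ^+ 2 / rho4 q.
Proof.
move=> qz; have n0 := rho4_gt0 qz.
pose c := 1 / 4 * rho4 q `^ (1 / 4 - 1).
have cE : c = rho q / rho4 q / 4.
  rewrite /c powRB ?(gt_eqF n0) ?implybT//.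
  rewrite powRr1 ?ltW//; have -> : rho4 q `^ (1 / 4) = rho q by [].
  by rewrite mulrC mulrA mulr1.
have D v : 'D_v (@rho R) q = c * (4 * r2 q * (cx q * cx v + cy q * cy v) + 32 * cz q * cz v).
  (* The derivative of [powR] is one-variable, hence the restriction of [rho] to the line through
     [q] in the direction [v]. *)
  pose L (s : R) : heis R := s *: v + q.
  have LE (h : R) : L (h + 0) = h *: v + L 0 by rewrite /L addr0 scale0r add0r.
  have L0 : L 0 = q by rewrite /L scale0r add0r.
  have D1 : is_derive (0 : R) (1 : R) (fun s => rho4 (L s)) (4 * r2 q * (cx q * cx v + cy q * cy v) + 32 * cz q * cz v).
    by apply: (is_derive_slice LE); rewrite L0; exact: is_derive_rho4.
  have D2 : is_derive (rho4 (L 0)) (1 : R) (fun s : R => s `^ (1 / 4)) c.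
    by rewrite L0; exact: is_derive1_powR.
  have [_ D3] := @is_derive1_comp _ (fun s : R => s `^ (1 / 4)) (fun s => rho4 (L s)) 0 _ _ D2 D1.
  have E : (fun h : R => h^-1 *: ((@rho R \o shift q) (h *: v) - rho q)) =
      (fun h : R => h^-1 *: (((fun s => rho4 (L s) `^ (1 / 4)) \o shift 0) (h *: (1 : R)) -
        rho4 (L 0) `^ (1 / 4))).
    by apply/funext => h /=; rewrite L0 addr0 [h *: 1]mulr1.
  by rewrite -D3 /derive E.
rewrite /hgrad_norm -[4%N]/(2 * 2)%N exprM sqr_sqrtr ?addr_ge0 ?sqr_ge0//.
rewrite /Xf /Yf !D !coordE cE -rho_rho4.
have p0 : rho q != 0 by apply: contra_neq (lt0r_neq0 n0); rewrite -rho_rho4 => ->; rewrite expr0n.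
have nE : rho q ^+ 4 = r2 q ^+ 2 + 16 * cz q ^+ 2 by exact: rho_rho4.
have r2E : r2 q = cx q ^+ 2 + cy q ^+ 2 by [].
move: nE p0 r2E; generalize (rho q) (r2 q) (cx q) (cy q) (cz q) => p s x y z nE p0 sE.
(* The inner expression is [(X rho)^2 + (Y rho)^2], with [X rho = (s x - 4 y z) / p^3] and
   [Y rho = (s y + 4 x z) / p^3]; the mixed terms cancel. *)
transitivity ((s * (s ^+ 2 + 16 * z ^+ 2) / p ^+ 6) ^+ 2); last by rewrite -nE; field.
by congr (_ ^+ 2); rewrite sE; field.
Qed.

End polar_derivatives.

Local Open Scope complex_scope.

(** * Translation of the complex quantities into real densities *)

Section complex_functions.
Variables (R : realType) (u : heis R -> R[i]).
Implicit Types (q : heis R).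

Lemma sqnE (w : R[i]) : sqn w = complex.Re w ^+ 2 + complex.Im w ^+ 2.
Proof. by case: w => a b; rewrite /sqn /= sqr_sqrtr// addr_ge0// sqr_ge0. Qed.

Let f q := complex.Re (u q).
Let g q := complex.Im (u q).
Hypotheses (sf : smooth f) (sg : smooth g).

Let fx q := 'D_e_x f q.
Let fy q := 'D_e_y f q.
Let fz q := 'D_e_z f q.
Let gx q := 'D_e_x g q.
Let gy q := 'D_e_y g q.
Let gz q := 'D_e_z g q.

Lemma partial_rE q : partial_r u q = (euler fx fy q / rr q) +i* (euler gx gy q / rr q).
Proof. by rewrite /partial_r /cderive1 -!derive1_radial. Qed.

Lemma partial_phiE q : partial_phi u q = angular fx fy q +i* angular gx gy q.
Proof. by rewrite /partial_phi /cderive1 -!derive1_angular. Qed.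

Lemma partial_zE q : partial_z u q = fz q +i* gz q.
Proof. by rewrite /partial_z /cderive1 /fz /gz -!derive1_vertical. Qed.

Lemma eq_Re_Im q : u q = f q +i* g q.
Proof. by rewrite /f /g; case: (u q). Qed.

Lemma PhiE q : Phi u q = ((rr q)^-1 * angular fx fy q + rr q / 2 * fz q) +i*
  ((rr q)^-1 * angular gx gy q + rr q / 2 * gz q).
Proof.
rewrite /Phi partial_phiE partial_zE.
generalize (angular fx fy q) (angular gx gy q) (fz q) (gz q) => a a' c c'.
by apply/eqP; rewrite eq_complex /= !mul0r !subr0 !addr0 !eqxx.
Qed.

Lemma Qform_energy alpha : Qform alpha u = hintegral (energy_density f g fx fy fz gx gy gz alpha).
Proof.
congr hintegral; apply/funext => q; rewrite partial_rE PhiE eq_Re_Im !sqnE /energy_density.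
generalize (euler fx fy q) (euler gx gy q) (angular fx fy q) (angular gx gy q) (fz q) (gz q) (f q) (g q).
move=> e e' a a' c c' k k' /=.
(* The densities have to agree on the axis too: there both sides are 0, the inverse of 0 being 0. *)
have [r0|r0] := eqVneq (rr q) 0.
  have s0 : r2 q = 0 by apply/eqP; rewrite -rr_eq0 r0.
  by rewrite r0 s0 !invr0; ring.
by rewrite -sqr_rr; field.
Qed.

Lemma hardy_weightedE : hardy_weighted u = hintegral (fun q => r2 q / rho4 q * sqmod f g q).
Proof. by congr hintegral; apply/funext => q; rewrite sqr_rr rho_rho4 sqnE. Qed.

Lemma inv_square_weightedE : inv_square_weighted u = hintegral (fun q => sqmod f g q / r2 q).
Proof. by congr hintegral; apply/funext => q; rewrite sqr_rr sqnE. Qed.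

Lemma inv_square_weighted_gradE :
  inv_square_weighted_grad u = hintegral (fun q => sqmod f g q / r2 q * (1 - r2 q ^+ 2 / rho4 q)).
Proof.
congr hintegral; apply/funext => q; rewrite sqr_rr sqnE -/(sqmod f g q).
have [qz|qz] := pselect (zaxis q); last by rewrite hgrad_norm_rho.
by case: qz => x0 y0; rewrite /r2 x0 y0 expr0n /= addr0 invr0 mulr0 !mul0r.
Qed.

Lemma inner_PhiE : inner (fun q => - 'i%C * Phi u q) (fun q => u q * (rr q)^-1%:C) =
  hintegral (current_density f g fx fy fz gx gy gz) +i*
  hintegral (fun q => - (((angular fx fy q + r2 q / 2 * fz q) * f q +
   (angular gx gy q + r2 q / 2 * gz q) * g q) / r2 q)).
Proof.
congr (_ +i* _); congr hintegral; apply/funext => q; rewrite PhiE eq_Re_Im /current_density;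
  generalize (angular fx fy q) (angular gx gy q) (fz q) (gz q) (f q) (g q) => a a' c c' k k' /=;
  (have [r0|r0] := eqVneq (rr q) 0;
    [by have s0 : r2 q = 0 by [apply/eqP; rewrite -rr_eq0 r0]; rewrite r0 s0 !invr0; ring
    |by rewrite -sqr_rr; field]).
Qed.

End complex_functions.

Theorem proposition7p1 (R : realType) (alpha : R) (n : int) (gamma : R)
    (hsplit : splits alpha n gamma)
    (u : heis R -> R[i]) (hu : test_function u) :
  (* (i) *)
  ((angular_condition n gamma u ->
      Qform alpha u - hardy_weighted u
        >= distZ alpha ^+ 2 * inv_square_weighted u) /\
   ((forall q, complex.Im (u q) = 0) ->
      [/\ 0 <= gamma * n%:~R ->
            angular_condition n gamma u /\
            Qform alpha u - hardy_weighted u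
              >= distZ alpha ^+ 2 * inv_square_weighted u,
          `|alpha| < 1 / 2 -> 0 <= gamma * n%:~R
        & `|alpha| <= 1 / 2 ->
            (exists (m : int) (delta : R),
               splits alpha m delta /\ 0 <= delta * m%:~R) /\
            Qform alpha u - hardy_weighted u
              >= distZ alpha ^+ 2 * inv_square_weighted u])) /\
  (* (ii) *)
  ((forall q, ~ zaxis q -> - 'i%C * partial_phi u q = n%:~R * u q) \/
   (forall x y z : R, u (x, y, z) = u (x, y, - z)) ->
   Qform alpha u - hardy_weighted u
     >= distZ alpha ^+ 2 * inv_square_weighted_grad u).
Proof.
have [sf sg cS Sax] := hu; set S := csupport u in cS Sax.
set f := fun q => complex.Re (u q) in sf; set g := fun q => complex.Im (u q) in sg.
have clS : closed S by exact: closed_closure.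
have u0 q : ~ S q -> u q = 0.
  by move=> Sq; apply: contrapT => /eqP uq; apply: Sq; exact: subset_closure.
have f0 q : ~ S q -> f q = 0 by move=> Sq; rewrite /f u0.
have g0 q : ~ S q -> g q = 0 by move=> Sq; rewrite /g u0.
have gammaE := splits_sqr hsplit.
have angE m delta : angular_condition m delta u <-> 0 <= delta *
    (hintegral (current_density f g (fun q => 'D_e_x f q) (fun q => 'D_e_y f q) (fun q => 'D_e_z f q)
       (fun q => 'D_e_x g q) (fun q => 'D_e_y g q) (fun q => 'D_e_z g q)) +
     m%:~R * hintegral (fun q => sqmod f g q / r2 q)).
  rewrite /angular_condition inner_PhiE// inv_square_weightedE.
  rewrite (skew_phi cS clS Sax sf sg f0 g0 erefl erefl erefl erefl erefl erefl) -/f -/g.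
  (* The imaginary part being 0, the comparison in [R[i]] reduces to that of the real parts. *)
  set J := hintegral _; set I := hintegral _; rewrite lecE /= !mulr0 mul0r addr0 eqxx /= subr0.
  by split; lra.
have hardy m delta : splits alpha m delta -> angular_condition m delta u ->
    Qform alpha u - hardy_weighted u >= distZ alpha ^+ 2 * inv_square_weighted u.
  move=> sp; rewrite -(splits_sqr sp) => /angE cond.
  rewrite Qform_energy// hardy_weightedE inv_square_weightedE; case: sp => aE _.
  exact: (hardy_magnetic cS clS Sax sf sg f0 g0 erefl erefl erefl erefl erefl erefl aE cond).
split; first split; first exact: hardy.
  (* A real function has zero current, so the condition reduces to [delta m] times a nonnegative
     integral. *)
  move=> ureal; have real_cond (m : int) (delta : R) : 0 <= delta * m%:~R -> angular_condition m delta u.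
    move=> dm; apply/angE.
    have g00 : g = (fun=> 0) by apply/funext => q; exact: ureal.
    have dg0 v q : 'D_v g q = 0 by rewrite g00; exact: derive_cst.
    have -> : hintegral (current_density f g (fun q => 'D_e_x f q) (fun q => 'D_e_y f q) (fun q => 'D_e_z f q)
       (fun q => 'D_e_x g q) (fun q => 'D_e_y g q) (fun q => 'D_e_z g q)) = 0.
      rewrite -(hintegral0 R); congr hintegral; apply/funext => q.
      rewrite /current_density /angular !dg0 g00; set a := 'D_e_x f q; set b := 'D_e_y f q; set c := 'D_e_z f q.
      by ring.
    rewrite add0r mulrA; apply: mulr_ge0 => //; apply: hintegral_ge0.
      by move=> q qz; rewrite divr_ge0 ?addr_ge0 ?sqr_ge0.
    by move=> q [x0 y0]; rewrite /r2 x0 y0 expr0n addr0 invr0 mulr0.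
  split=> [gn|a2|a2].
  - by have c := real_cond _ _ gn; split=> //; exact: hardy c.
  - by rewrite (splits_small hsplit a2) mulr0.
  (* At [|alpha| = 1 / 2] the given splitting may have [gamma n < 0]; [alpha = 0 + alpha] serves
     instead, and the conclusion involves only [distZ alpha]. *)
  - have sp := splits0 a2; have c0 : 0 <= alpha * 0%:~R by rewrite mulr0.
    by split; [exists 0, alpha|exact: hardy sp (real_cond _ _ c0)].
rewrite Qform_energy// hardy_weightedE inv_square_weighted_gradE -gammaE.
have g2 := splits_le_half hsplit.
case=> [eig|even].
  have g4 : gamma ^+ 2 <= 1 / 4 by move: g2; rewrite ler_norml => /andP[h1 h2]; nra.
  apply: (hardy_eigen cS clS Sax sf sg f0 g0 erefl erefl erefl erefl erefl erefl g4 (splits_sqr_le hsplit)).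
  move=> q qz; have := eig q qz; rewrite partial_phiE// (eq_Re_Im u q) -/f -/g.
  have -> : n%:~R = (n%:~R : R)%:C by rewrite rmorph_int.
  set a := angular _ _ _; set b := angular _ _ _ => /eqP; rewrite eq_complex /= => /andP[/eqP E1 /eqP E2].
  by split; [rewrite -[a]opprK -mulrN|]; lra.
(* In the even case the bound holds even with the full weight [1 / r^2], which dominates the weight
   claimed. *)
apply: (@le_trans _ _ (gamma ^+ 2 * hintegral (fun q => sqmod f g q / r2 q))).
  apply: ler_wpM2l; first exact: sqr_ge0.
  exact: (inv_square_grad_le cS clS Sax sf sg f0 g0 erefl erefl erefl erefl erefl erefl).
apply: (le_trans (angular_wirtinger cS clS Sax sf sg f0 g0 erefl erefl erefl erefl erefl erefl hsplit.1 g2)).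
apply: (hardy_even cS clS Sax sf sg f0 g0 erefl erefl erefl erefl erefl erefl).
- by case=> [[x y] z]; rewrite /f /reflz /cx /cy /cz /= -even.
- by case=> [[x y] z]; rewrite /g /reflz /cx /cy /cz /= -even.
Qed.
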